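(* Let $\alpha:\mathbb{R}\to\mathbb{R}$ be a locally Lipschitz extended class $\mathcal{K}$ function, let $\varepsilon>0$, and define the constraint map $$\mathcal{U}_{\mathrm{str}}(\mathbf{x}) := \{\mathbf{u}\in\mathbb{R}^N \mid \mu_{[2:n]}(\mathbf{x},\mathbf{u})\ge -\alpha(\lambda_2(\mathbf{x})-\varepsilon)\}.$$ Assume that $J$ and $g_{\mathrm{nom}}$ are continuous, that $J$ is strictly convex in $\mathbf{u}$, and that $g_{\mathrm{nom}}$ is convex in $\mathbf{u}$. Suppose that, for each $\mathbf{x}$, there exists a control input $\mathbf{u}\in\mathbb{R}^N$ that strictly satisfies the constraint map $\mathcal{U}_{\mathrm{str}}\cap\mathcal{U}_{\mathrm{nom}}(\mathbf{x})$, i.e., $\mu_{[2:n]}(\mathbf{x},\mathbf{u}) > -\alpha(\lambda_2(\mathbf{x})-\varepsilon)$ and $g_{\mathrm{nom}}(\mathbf{x},\mathbf{u})<0$ (componentwise). Then the optimization-based controller $$\mathbf{k}_{\mathrm{str}}(\mathbf{x}) := \underset{\mathbf{u}\in\mathcal{U}_{\mathrm{str}}(\mathbf{x})\cap\mathcal{U}_{\mathrm{nom}}(\mathbf{x})}{\arg\min}\ J(\mathbf{x},\mathbf{u})$$ is continuous on $\mathcal{C}_\varepsilon=\{\mathbf{x}\in\mathbb{R}^N\mid \lambda_2(\mathbf{x})\ge\varepsilon\}$. In addition, for any initial condition $\mathbf{x}_0\in\mathcal{C}_\varepsilon$, along the Carathéodory solutions $t\mapsto\mathbf{x}(t)$ of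 the closed-loop system $\dot{\mathbf{x}}=\mathbf{k}_{\mathrm{str}}(\mathbf{x})$ with $\mathbf{x}(0)=\mathbf{x}_0$ one has $\lambda_2(\mathbf{x}(t))\ge\varepsilon$ at all times (so that network connectivity is maintained).
   Context: Multi-robot system: $n$ robots with dynamics $\dot x_r=u_r$, $x_r,u_r\in\mathbb{R}^{d_r}$, $r\in[n]=\{1,\dots,n\}$; $N=\sum_r d_r$, $\mathbf{x}=[x_1^\top,\dots,x_n^\top]^\top\in\mathbb{R}^N$, $\mathbf{u}=[u_1^\top,\dots,u_n^\top]^\top\in\mathbb{R}^N$, so $\dot{\mathbf{x}}=\mathbf{u}$. Write $[m:n]=\{m,\dots,n\}$. The interaction topology is a state-dependent undirected weighted graph on vertex set $[n]$ with symmetric, entrywise nonnegative adjacency matrix $\mathbf{A}(\mathbf{x})\in\mathbb{R}^{n\times n}$, where $\mathbf{x}\mapsto\mathbf{A}(\mathbf{x})$ is continuously differentiable; $\mathbf{A}_{ij}(\mathbf{x})>0$ iff $(i,j)$ is an edge. The Laplacian is $\mathbf{L}(\mathbf{x})=\mathbf{D}(\mathbf{x})-\mathbf{A}(\mathbf{x})$, with $\mathbf{D}$ diagonal and $\mathbf{D}_{ii}=\sum_j\mathbf{A}_{ij}$. Its eigenvalues are $0=\lambda_1(\mathbf{x})\le\lambda_2(\mathbf{x})\le\dots\le\lambda_n(\mathbf{x})$, counted with multiplicity; the graph is connected iff $\lambda_2(\mathbf{x})>0$. Let $\mathbb{S}^n$ denote the unit sphere in $\mathbb{R}^n$ (the set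 of $\mathbf{v}\in\mathbb{R}^n$ with $\|\mathbf{v}\|=1$). For $p\in[n]$, $\mathcal{V}_p(\mathbf{x})=\{\mathbf{v}\in\mathbb{S}^n\mid \mathbf{L}(\mathbf{x})\mathbf{v}=\lambda_p(\mathbf{x})\mathbf{v}\}$. For $\mathcal{I}\subseteq[n]$ nonempty, $\mathcal{V}_{\mathcal{I}}(\mathbf{x})=\mathrm{span}\{\bigcup_{p\in\mathcal{I}}\mathcal{V}_p(\mathbf{x})\}\cap\mathbb{S}^n$ and $$\mu_{\mathcal{I}}(\mathbf{x},\mathbf{u})=\min_{\mathbf{v}\in\mathcal{V}_{\mathcal{I}}(\mathbf{x})}\mathbf{v}^\top\Big(\sum_{i\in[N]}\frac{\partial\mathbf{L}}{\partial\mathbf{x}_i}(\mathbf{x})\,\mathbf{u}_i\Big)\mathbf{v},$$ where $\mathbf{x}_i,\mathbf{u}_i$ are the scalar components of $\mathbf{x},\mathbf{u}$. The cost function is $J:\mathbb{R}^N\times\mathbb{R}^N\to\mathbb{R}$, and the nominal constraint map is $\mathcal{U}_{\mathrm{nom}}(\mathbf{x})=\{\mathbf{u}\in\mathbb{R}^N\mid g_{\mathrm{nom}}(\mathbf{x},\mathbf{u})\le0\}$ (componentwise) with $g_{\mathrm{nom}}:\mathbb{R}^N\times\mathbb{R}^N\to\mathbb{R}^{d_{\mathrm{nom}}}$. Intersections of set-valued maps are pointwise. An extended class $\mathcal{K}$ function is a continuous strictly increasing $\alpha:\mathbb{R}\to\mathbb{R}$ with $\alpha(0)=0$. A Carathéodory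 solution is an absolutely continuous trajectory satisfying the dynamics at almost every time.
   Formalization: The minimum defining k_str(x) is assumed to be attained at every x; the stated hypotheses do not ensure this (e.g. constant weights, inactive constraints, J = e^{u_1} + u_2^2 has no minimizer), so the controller would otherwise be undefined. *)

(* Defs.v *)
From HB Require Import structures.
From mathcomp Require Import all_boot all_order all_algebra.
From mathcomp Require Import all_classical all_reals all_analysis.

Set Implicit Arguments.
Unset Strict Implicit.
Unset Printing Implicit Defensive.

Import Order.TTheory GRing.Theory Num.Theory.
Import numFieldNormedType.Exports.

Local Open Scope classical_set_scope.
Local Open Scope ring_scope.

(* Euclidean norm: the library norm `|v| on matrices is the max norm. *)
Definition norm2 (R : realType) (n : nat) (v : 'cV[R]_n) : R :=
  Num.sqrt (\sum_i v i 0 ^+ 2).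

Definition unit_sphere (R : realType) (n : nat) : set 'cV[R]_n :=
  [set v | norm2 v = 1].

Definition lin_span (R : realType) (V : lmodType R) (S : set V) : set V :=
  [set v | exists (m : nat) (c : 'I_m -> R) (w : 'I_m -> V),
     (forall i, S (w i)) /\ v = \sum_i c i *: w i].

(* The least element of S, and 0 if there is none. *)
Definition minimum (R : realType) (S : set R) : R := xget 0 (S `&` lbound S).

Definition argmin (R : realType) (T : Type) (U : set T) (f : T -> R) : set T :=
  [set u | U u /\ forall w, U w -> f u <= f w].

(* The eigenvalues in nondecreasing order with multiplicity; such a sequence
   is unique, and it exists when M is real symmetric. *)
Definition spectrum (R : realType) (n : nat) (M : 'M[R]_n) : seq R :=
  xget [::] [set s : seq R | sorted <=%R s /\
                             char_poly M = \prod_(a <- s) ('X - a%:P)].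

(* Numbered from 1: lambda M 1 <= lambda M 2 <= ... <= lambda M n. *)
Definition lambda (R : realType) (n : nat) (M : 'M[R]_n) (p : nat) : R :=
  nth 0 (spectrum M) p.-1.

Definition laplacian (R : realType) (n : nat) (A : 'M[R]_n) : 'M[R]_n :=
  diag_mx (\row_i \sum_j A i j) - A.

Definition graph_connected (R : realType) (n : nat) (A : 'M[R]_n) : Prop :=
  forall i j : 'I_n, connect [rel a b | 0 < A a b] i j.

(* In finite dimension, continuity of x |-> 'd f x for the operator norm
   amounts to continuity of x |-> 'd f x v for every v. *)
Definition continuously_differentiable (R : realType) (V W : normedModType R)
    (f : V -> W) : Prop :=
  (forall x, differentiable f x) /\
  (forall v, continuous (fun x => 'd f x v : W)).

Definition locally_lipschitz (R : realType) (f : R -> R) : Prop :=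
  forall t : R, exists (k : R) (B : set R), nbhs t B /\ k.-lipschitz_B f.

Definition extended_class_K (R : realType) (f : R -> R) : Prop :=
  [/\ continuous f, {homo f : s t / s < t} & f 0 = 0].

Definition strictly_convex (R : realType) (V : lmodType R) (f : V -> R) : Prop :=
  forall (u v : V) (t : R), u != v -> 0 < t < 1 ->
    f (t *: u + (1 - t) *: v) < t * f u + (1 - t) * f v.

Section Network.
Context (R : realType) (n N : nat) (A : 'cV[R]_N -> 'M[R]_n).

Definition Lap (x : 'cV[R]_N) : 'M[R]_n := laplacian (A x).

Definition lam (p : nat) (x : 'cV[R]_N) : R := lambda (Lap x) p.

Definition Vp (p : nat) (x : 'cV[R]_N) : set 'cV[R]_n :=
  [set v | unit_sphere v /\ Lap x *m v = lam p x *: v].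

Definition VI (I : set nat) (x : 'cV[R]_N) : set 'cV[R]_n :=
  lin_span (\bigcup_(p in I) Vp p x) `&` @unit_sphere R n.

Definition Lap_dot (x u : 'cV[R]_N) : 'M[R]_n :=
  \sum_(i < N) u i 0 *: 'D_(delta_mx i 0) Lap x.

Definition mu (I : set nat) (x u : 'cV[R]_N) : R :=
  minimum [set (v^T *m Lap_dot x u *m v) 0 0 | v in VI I x].

Definition U_str (alpha : R -> R) (eps : R) (x : 'cV[R]_N) : set 'cV[R]_N :=
  [set u | mu [set p | (2 <= p <= n)%N] x u >= - alpha (lam 2 x - eps)].

Definition C_ (eps : R) : set 'cV[R]_N := [set x | eps <= lam 2 x].

End Network.

Definition U_nom (R : realType) (N dnom : nat)
    (g : 'cV[R]_N * 'cV[R]_N -> 'cV[R]_dnom) (x : 'cV[R]_N) : set 'cV[R]_N :=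
  [set u | forall i, g (x, u) i 0 <= 0].

Definition abs_continuous (R : realType) (V : normedModType R) (a b : R)
    (f : R -> V) : Prop :=
  forall e : R, 0 < e -> exists2 delta : R, 0 < delta &
    forall (m : nat) (s t : 'I_m -> R),
      (forall i, [/\ a <= s i, s i <= t i & t i <= b]) ->
      (forall i j, i != j -> t i <= s j \/ t j <= s i) ->
      \sum_i (t i - s i) < delta ->
      \sum_i `|f (t i) - f (s i)| < e.

(* Solution of x' = k(x), x(0) = x0, on an interval I of the form [0, T],
   [0, T[ or [0, +oo[; the values of x outside I are irrelevant. *)
Definition caratheodory_solution (R : realType) (V : normedModType R)
    (k : V -> V) (x0 : V) (I : set R) (x : R -> V) : Prop :=
  [/\ is_interval I /\ I `<=` [set t | 0 <= t],
      I 0 /\ x 0 = x0,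
      (forall a b, I a -> I b -> abs_continuous a b x) &
      {ae (@lebesgue_measure R), forall t : R, I t ->
          is_derive (t : R^o) (1 : R^o) (x : R^o -> V) (k (x t))}].

(* Main.v *)
Require Import Defs.
From HB Require Import structures.
From mathcomp Require Import all_boot all_order all_algebra.
From mathcomp Require Import all_classical all_reals all_analysis.
From mathcomp Require Import ring lra.

Set Implicit Arguments.
Unset Strict Implicit.
Unset Printing Implicit Defensive.

Import Order.TTheory GRing.Theory Num.Theory.
Import numFieldNormedType.Exports.

Local Open Scope classical_set_scope.
Local Open Scope ring_scope.

(** Let K be the compact set of unit vectors orthogonal to the all-ones
vector. The whole argument reduces to inequalities between quadratic forms
tested on the vectors of K, a set that does not depend on the state.

Why K governs everything. Strict feasibility is assumed at every state, and
this forces lambda_2 to be nonzero everywhere. Indeed, where lambda_2 = 0 the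
normalized all-ones vector belongs to the set over which mu minimizes; every
directional derivative of the Laplacian annihilates it, so mu <= 0 there,
whereas strict feasibility demands mu > - alpha (- eps) > 0 ([mu_le0]). Once
lambda_2 is nonzero, the kernel of the Laplacian is spanned by the all-ones
vector ([laplacian_ker]), the eigenvectors numbered 2 to n span its orthogonal
complement ([VI_connected]), and so both mu and lambda_2 are minima over K:
mu of the derivative of the Laplacian along u, lambda_2 of the Laplacian
itself ([mu_attained], [lambda2_eigenvector], [lambda2_le_quad]). Connectivity
of the graph is another face of the same fact: the indicator of a connected
component is in the kernel ([laplacian_connected]).

Continuity of the controller. Since K is compact, lambda_2 is continuous
([continuous_lam2]), and the connectivity constraint becomes a family, indexed
by K, of inequalities that are affine in u and jointly continuous. Together
with the nominal constraints this gives a feasible set that is convex, has a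
closed graph, and contains near any state the points of a segment that leads
to a Slater point. For such feasible sets the minimizer of a strictly convex
cost depends continuously on the state ([continuous_argmin]).

Invariance. The function lambda_2 may fail to be differentiable where it is a
multiple eigenvalue, so it is never differentiated. Suppose that
lambda_2 < eps at some time T, and let c be the last earlier time with
lambda_2 >= eps. On [c, T] the constraint bounds the derivative of
v^T L(x(t)) v from below by - alpha (lambda_2 - eps) >= 0, for every fixed v
in K and almost every t. This function of t is therefore nondecreasing
([ae_nondecreasing]), and for a minimizer v at time T one gets
lambda_2(x(T)) = v^T L(x(T)) v >= v^T L(x(c)) v >= lambda_2(x(c)) >= eps, a
contradiction ([quad_Lap_path_le], [lam2_solution_ge]). *)

(** * Geometric and algebraic multiplicity *)

(** In a basis whose first r vectors span the eigenspace, the first r rows of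
'X - M are multiples of 'X - a; these factors come out of the determinant. *)
Lemma geometric_le_algebraic_mult (F : fieldType) (n : nat) (M : 'M[F]_n) (a : F) :
  ('X - a%:P) ^+ \rank (eigenspace M a) %| char_poly M.
Proof.
set E := eigenspace M a; set r := \rank E.
pose P := row_ebase E.
pose pd : 'M[F]_n := pid_mx r.
have rn : (r <= n)%N by exact: rank_leq_col.
have pdP : pd *m P *m M = a *: (pd *m P).
  apply/eigenspaceP; rewrite -/E -[X in (_ <= X)%MS]mulmx_ebase -mulmxA.
  apply/submxP; exists (invmx (col_ebase E)).
  by rewrite mulKmx ?col_ebase_unit.
pose PP := map_mx (@polyC F) P; pose pp : 'M[{poly F}]_n := pid_mx r.
pose cp : 'M[{poly F}]_n := 1%:M - pp.
pose chi := char_poly_mx M.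
have ppE : pp = map_mx (@polyC F) pd by rewrite /pp map_pid_mx.
have key : pp *m PP *m chi = ('X - a%:P) *: (pp *m PP).
  rewrite /chi /char_poly_mx mulmxBr mul_mx_scalar scalerBl; congr (_ - _).
  by rewrite ppE -!map_mxM pdP map_mxZ.
have pp2 : pp *m pp = pp by rewrite pid_mx_id.
have cppp : cp *m pp = 0 by rewrite mulmxBl mul1mx pp2 subrr.
have ppcp : pp *m cp = 0 by rewrite mulmxBr mulmx1 pp2 subrr.
have cp2 : cp *m cp = cp by rewrite {1}/cp mulmxBl mul1mx ppcp subr0.
pose D := ('X - a%:P) *: pp + cp.
(* D factors 'X - a out of the first r rows of PP *m chi *)
have fact : PP *m chi = D *m (pp *m PP + cp *m PP *m chi).
  move: chi key => chi key.
  rewrite /D mulmxDl !mulmxDr -!scalemxAl !mulmxA pp2 ppcp cppp cp2 !mul0mx.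
  rewrite scaler0 !addr0 add0r -key -!mulmxA -mulmxDl.
  by rewrite /cp addrC subrK mul1mx.
have detD : \det D = ('X - a%:P) ^+ r.
  have -> : D = diag_mx (\row_i if (i < r)%N then 'X - a%:P else 1).
    apply/matrixP => i j; rewrite !mxE.
    have [<-|ij] := eqVneq i j; last first.
      by rewrite /= (negbTE (_ : nat_of_ord i != j)) //= ?mulr0 ?subrr ?addr0.
    rewrite eqxx /=; case: (ltnP i r) => ir /=.
      by rewrite mulr1 subrr addr0.
    by rewrite mulr0 subr0 add0r.
  rewrite det_diag.
  under eq_bigr do rewrite mxE.
  rewrite -big_mkcond /= -(big_ord_widen n (fun=> 'X - a%:P) rn).
  by rewrite prodr_const card_ord.
have := congr1 determinant fact; rewrite !det_mulmx detD det_map_mx => detE.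
rewrite -(dvdpZr _ _ (_ : \det P != 0)); last first.
  by rewrite -unitfE -unitmxE row_ebase_unit.
by rewrite -mul_polyC detE dvdp_mulr.
Qed.

(** * Inner products and quadratic forms *)

Section Dot.
Context (R : realType).

Definition dot (n : nat) (u v : 'cV[R]_n) : R := (u^T *m v) 0 0.

Definition quad (n : nat) (M : 'M[R]_n) (v : 'cV[R]_n) : R :=
  (v^T *m M *m v) 0 0.

Context (n : nat).
Implicit Types (u v w : 'cV[R]_n) (M : 'M[R]_n).

Lemma quadE M v : quad M v = dot v (M *m v).
Proof. by rewrite /quad /dot mulmxA. Qed.

Lemma dotE u v : dot u v = \sum_i u i 0 * v i 0.
Proof. by rewrite /dot mxE; apply: eq_bigr => i _; rewrite mxE. Qed.

Lemma dotC u v : dot u v = dot v u.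
Proof. by rewrite !dotE; apply: eq_bigr => i _; rewrite mulrC. Qed.

Lemma dotDl u v w : dot (u + v) w = dot u w + dot v w.
Proof. by rewrite /dot linearD /= mulmxDl mxE. Qed.

Lemma dotDr u v w : dot u (v + w) = dot u v + dot u w.
Proof. by rewrite /dot mulmxDr mxE. Qed.

Lemma dotZl (a : R) u v : dot (a *: u) v = a * dot u v.
Proof. by rewrite /dot linearZ /= -scalemxAl mxE. Qed.

Lemma dotZr (a : R) u v : dot u (a *: v) = a * dot u v.
Proof. by rewrite dotC dotZl dotC. Qed.

Lemma dotBr u v w : dot u (v - w) = dot u v - dot u w.
Proof. by rewrite dotDr -scaleN1r dotZr mulN1r. Qed.

Lemma dot0r u : dot u 0 = 0.
Proof. by rewrite /dot mulmx0 mxE. Qed.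

Lemma dot_ge0 u : 0 <= dot u u.
Proof. by rewrite dotE sumr_ge0 // => i _; rewrite -expr2 sqr_ge0. Qed.

Lemma dot_eq0 u : (dot u u == 0) = (u == 0).
Proof.
apply/idP/idP => [|/eqP ->]; last by rewrite dot0r.
rewrite dotE psumr_eq0 => [/allP u0|i _]; last by rewrite -expr2 sqr_ge0.
apply/eqP/matrixP => i j; rewrite ord1 mxE; apply/eqP.
by have := u0 i; rewrite mem_index_enum mulf_eq0 orbb => /(_ isT).
Qed.

Lemma dot_sym M u v : M^T = M -> dot u (M *m v) = dot (M *m u) v.
Proof. by move=> Ms; rewrite /dot trmx_mul Ms mulmxA. Qed.

Lemma unit_sphereE v : unit_sphere v = (dot v v = 1) :> Prop.
Proof.
rewrite propeqE /unit_sphere /= /norm2.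
have -> : \sum_i v i 0 ^+ 2 = dot v v.
  by rewrite dotE; apply: eq_bigr => i _; rewrite expr2.
split=> [v1|->]; last by rewrite sqrtr1.
by rewrite -(sqr_sqrtr (dot_ge0 v)) v1 expr1n.
Qed.

Lemma unit_sphere_neq0 v : unit_sphere v -> v != 0.
Proof. by rewrite unit_sphereE -dot_eq0 => ->; rewrite oner_eq0. Qed.

Lemma normalize u : u != 0 ->
  unit_sphere ((Num.sqrt (dot u u))^-1 *: u).
Proof.
move=> u0; rewrite unit_sphereE dotZl dotZr mulrA -expr2 exprVn.
by rewrite sqr_sqrtr ?dot_ge0 // mulVf // dot_eq0.
Qed.

Lemma quadDZ M v w (t : R) : M^T = M ->
  quad M (v + t *: w) = quad M v + 2 * t * dot w (M *m v) + t ^+ 2 * quad M w.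
Proof.
move=> Ms; rewrite !quadE mulmxDr -scalemxAr !dotDl !dotDr !dotZl !dotZr.
by rewrite (dot_sym v w Ms) (dotC (M *m v)); ring.
Qed.

Lemma quadZ M v (t : R) : quad M (t *: v) = t ^+ 2 * quad M v.
Proof. by rewrite !quadE -scalemxAr dotZl dotZr; ring. Qed.

Lemma quad_eigen M v (a : R) : unit_sphere v -> M *m v = a *: v -> quad M v = a.
Proof. by rewrite unit_sphereE quadE => v1 ->; rewrite dotZr v1 mulr1. Qed.

End Dot.

(** * Continuity and compactness for matrices, and Rayleigh quotients *)

Section Topology.
Context (R : realType).

Lemma cvg_mx (T : Type) (F : set_system T) (m n : nat) (f : T -> 'M[R]_(m, n))
    (M : 'M[R]_(m, n)) : Filter F ->
  (forall i j, f x i j @[x --> F] --> M i j) -> f x @[x --> F] --> M.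
Proof.
move=> FF fM S [P MP PS].
have /filter_forall : forall ij : 'I_m * 'I_n, F [set x | P ij.1 ij.2 (f x ij.1 ij.2)].
  by move=> [i j]; apply: fM; exact: MP.
by apply: filterS => x Px; apply: PS => i j; exact: (Px (i, j)).
Qed.

Lemma continuous_mx (T : topologicalType) (m n : nat) (f : T -> 'M[R]_(m, n)) :
  (forall i j, continuous (fun x => f x i j)) -> continuous f.
Proof. by move=> cf x; apply: cvg_mx => i j; exact: cf. Qed.

Lemma continuous_entry (T : topologicalType) (m n : nat) (f : T -> 'M[R]_(m, n)) i j :
  continuous f -> continuous (fun x => f x i j).
Proof.
move=> cf x; apply: (@continuous_comp _ _ _ f (fun M => M i j)); first exact: cf.
exact: coord_continuous.
Qed.

Lemma continuous_sum (T : topologicalType) (I : finType) (f : I -> T -> R) :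
  (forall i, continuous (f i)) -> continuous (fun x => \sum_i f i x).
Proof. by move=> cf; apply: continuous_big => //; exact: add_continuous. Qed.

Lemma continuous_mul (T : topologicalType) (f g : T -> R) :
  continuous f -> continuous g -> continuous (fun x => f x * g x).
Proof. by move=> cf cg x; apply: continuousM; [exact: cf|exact: cg]. Qed.

Lemma continuous_add (T : topologicalType) (f g : T -> R) :
  continuous f -> continuous g -> continuous (fun x => f x + g x).
Proof. by move=> cf cg x; apply: continuousD; [exact: cf|exact: cg]. Qed.

Lemma continuous_sub (T : topologicalType) (f g : T -> R) :
  continuous f -> continuous g -> continuous (fun x => f x - g x).
Proof. by move=> cf cg x; apply: continuousB; [exact: cf|exact: cg]. Qed.

Lemma continuous_opp (T : topologicalType) (f : T -> R) :
  continuous f -> continuous (fun x => - f x).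
Proof. by move=> cf x; apply: continuousN; exact: cf. Qed.

Lemma continuous_mulmx (T : topologicalType) (m n p : nat)
    (f : T -> 'M[R]_(m, n)) (g : T -> 'M[R]_(n, p)) :
  continuous f -> continuous g -> continuous (fun x => f x *m g x).
Proof.
move=> cf cg; apply: continuous_mx => i j.
rewrite (_ : (fun x => _) = (fun x => \sum_k f x i k * g x k j)); last first.
  by apply/funext => x; rewrite mxE.
by apply: continuous_sum => k; apply: continuous_mul; exact: continuous_entry.
Qed.

Lemma continuous_trmx (T : topologicalType) (m n : nat) (f : T -> 'M[R]_(m, n)) :
  continuous f -> continuous (fun x => (f x)^T).
Proof.
move=> cf; apply: continuous_mx => i j.
rewrite (_ : (fun x => _) = (fun x => f x j i)); last first.
  by apply/funext => x; rewrite mxE.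
exact: continuous_entry.
Qed.

Lemma continuous_quad (T : topologicalType) (n : nat) (M : T -> 'M[R]_n)
    (v : T -> 'cV[R]_n) :
  continuous M -> continuous v -> continuous (fun x => quad (M x) (v x)).
Proof.
move=> cM cv; apply: continuous_entry; apply: continuous_mulmx => //.
by apply: continuous_mulmx => //; exact: continuous_trmx.
Qed.

Lemma mx_norm_leP (m n : nat) (M : 'M[R]_(m, n)) (c : R) : 0 <= c ->
  (forall i j, `|M i j| <= c) -> `|M| <= c.
Proof.
move=> c0 Mc; rewrite (_ : `|M| = mx_norm M) // mx_normrE.
by apply/bigmax_leP; split => // -[i j] _; exact: Mc.
Qed.

Lemma mx_norm_ge_entry (m n : nat) (M : 'M[R]_(m, n)) i j : `|M i j| <= `|M|.
Proof.
rewrite (_ : `|M| = mx_norm M) // mx_normrE.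
exact: (le_bigmax _ (fun ij : 'I_m * 'I_n => `|M ij.1 ij.2|) (i, j)).
Qed.

Lemma compact_cV (n : nat) (A : set 'cV[R]_n) :
  bounded_set A -> closed A -> compact A.
Proof.
move=> [M [Mreal MA]] Acl.
have tc (p q : nat) : continuous (fun v : 'M[R]_(p, q) => v^T).
  by apply: continuous_trmx => x; exact: cvg_id.
rewrite (_ : A = (fun v : 'rV[R]_n => v^T) @` [set v | A v^T]); last first.
  apply/seteqP; split=> [v Av|_ [v Av <-] //]; exists v^T; last exact: trmxK.
  by rewrite /= trmxK.
apply: continuous_compact; first exact/continuous_subspaceT/tc.
apply: bounded_closed_compact.
  exists M; split => // x Mx v Av; have := MA x Mx _ Av.
  move=> /= vx; apply: mx_norm_leP; first exact: le_trans vx.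
  by move=> i j; rewrite -[v]trmxK mxE; apply: le_trans vx; exact: mx_norm_ge_entry.
by apply: (preimage_closed _ Acl) => v _; exact: tc.
Qed.

(** The constraint B v = 0 is kept as a matrix equation so that one statement
covers the whole sphere of an invariant subspace; it is closed because it says
that the quadratic form of B^T B vanishes. *)
Lemma compact_unit_ker (n k : nat) (B : 'M[R]_(k, n)) :
  compact [set v : 'cV[R]_n | unit_sphere v /\ B *m v = 0].
Proof.
have idc : continuous (fun v : 'cV[R]_n => v) by move=> v; exact: cvg_id.
have qc M : continuous (fun v : 'cV[R]_n => quad M v).
  by apply: (@continuous_quad _ _ (fun=> M) id) => //; exact: cst_continuous.
apply: compact_cV.
  exists 1; split => // x x1 v [/= + _]; rewrite unit_sphereE => v1.
  apply/(le_trans _ (ltW x1))/mx_norm_leP => // i j.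
  rewrite ord1 -(@ler_pXn2r _ 2) ?nnegrE // expr1n real_normK ?num_real //.
  rewrite -[leRHS]v1 dotE (bigD1 i) //= -expr2 lerDl sumr_ge0 // => l _.
  by rewrite -expr2 sqr_ge0.
rewrite (_ : mkset _ = (quad 1%:M @^-1` [set x | x = 1])
                   `&` (quad (B^T *m B) @^-1` [set x | x = 0])).
  by apply: closedI; apply: preimage_closed => // v _; exact: qc.
apply/seteqP; split => v /=; rewrite unit_sphereE !quadE mul1mx.
  by move=> [-> Bv]; rewrite -mulmxA Bv mulmx0 dot0r.
move=> [->] /eqP; rewrite -mulmxA => Bv; split=> //; apply/eqP.
by rewrite -dot_eq0; move: Bv; rewrite /dot trmx_mul !mulmxA.
Qed.

(** A minimizer v of the quadratic form on the unit sphere of the kernel of B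
exists by compactness. As the kernel is invariant, the residual
z = M v - a v lies in it, and first-order optimality in the direction z gives
z^T z = 0, which makes v an eigenvector. *)
Lemma rayleigh (n k : nat) (M : 'M[R]_n) (B : 'M[R]_(k, n)) :
  M^T = M -> (forall w : 'cV[R]_n, B *m w = 0 -> B *m (M *m w) = 0) ->
  (exists2 w : 'cV[R]_n, w != 0 & B *m w = 0) ->
  exists (v : 'cV[R]_n) (a : R),
    [/\ unit_sphere v, B *m v = 0, M *m v = a *: v &
        forall w, unit_sphere w -> B *m w = 0 -> a <= quad M w].
Proof.
move=> Ms Binv [w0 w00 Bw0].
have [||v] := @compact_EVT_min _ R (quad M) _ _ (@compact_unit_ker n k B).
- exists ((Num.sqrt (dot w0 w0))^-1 *: w0); split; first exact: normalize.
  by rewrite -scalemxAr Bw0 scaler0.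
- apply/continuous_subspaceT/(@continuous_quad _ _ (fun=> M) id); first exact: cst_continuous.
  by move=> x; exact: cvg_id.
rewrite inE => -[v1 Bv] vmin; set a := quad M v in vmin.
have amin w : B *m w = 0 -> a * dot w w <= quad M w.
  move=> Bw; have [->|w0'] := eqVneq w 0.
    by rewrite dot0r quadE mulmx0 dot0r mulr0.
  set s := Num.sqrt (dot w w).
  have s0 : s != 0 by rewrite gt_eqF // sqrtr_gt0 lt_neqAle eq_sym dot_eq0 w0' dot_ge0.
  have /vmin : s^-1 *: w \in [set v : 'cV[R]_n | unit_sphere v /\ B *m v = 0].
    rewrite inE; split; first exact: normalize.
    by rewrite -scalemxAr Bw scaler0.
  rewrite -/a quadZ exprVn sqr_sqrtr ?dot_ge0 // mulrC ler_pdivlMr //.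
  by rewrite lt_neqAle eq_sym dot_eq0 w0' dot_ge0.
exists v, a; split => //; last by move=> w w1 Bw; apply: vmin; rewrite inE.
apply/eqP; rewrite -subr_eq0 -dot_eq0; set z := M *m v - a *: v.
have Bz : B *m z = 0 by rewrite mulmxBr -scalemxAr Bv scaler0 subr0 Binv.
have vv : dot v v = 1 by move: v1; rewrite unit_sphereE.
have zMv : dot z (M *m v) = dot z z + a * dot z v by rewrite dotBr dotZr subrK.
move: z Bz zMv => z Bz zMv.
(* first-order optimality of v in the direction z *)
have H (t : R) : 0 <= 2 * t * dot z z + t ^+ 2 * (quad M z - a * dot z z).
  have /amin : B *m (v + t *: z) = 0 by rewrite mulmxDr -scalemxAr Bv Bz scaler0 addr0.
  rewrite quadDZ // -/a -subr_ge0 !(dotDl, dotDr, dotZl, dotZr) vv zMv (dotC v z).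
  by congr (0 <= _); ring.
have zz := dot_ge0 z; set c := quad M z - _ in H.
rewrite eq_le zz andbT leNgt; apply/negP => z0.
have c0 : 0 < `|c| + 1 by rewrite ltr_wpDl.
(* this step length keeps the quadratic term below the linear one *)
have := H (- (dot z z / (`|c| + 1))).
set q := dot z z; set e := q / _.
have e0 : 0 < e by rewrite divr_gt0.
have ce : e * c <= q.
  rewrite (le_trans (y := e * (`|c| + 1))) //.
    by rewrite ler_pM2l // (le_trans (ler_norm _)) // lerDl.
  by rewrite /e divfK // gt_eqF.
move: (mulr_gt0 e0 z0) (ler_wpM2l (ltW e0) ce); rewrite -/q.
by move: (e) (q) (c); clear => x y z *; lra.
Qed.

End Topology.

(** * Eigenvectors of symmetric matrices *)

Section Symmetric.
Context (R : realType) (n : nat).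
Implicit Types (M : 'M[R]_n) (v w u : 'cV[R]_n).

Lemma eigen_row M v (a : R) : M^T = M -> M *m v = a *: v ->
  (v^T <= eigenspace M a)%MS.
Proof. by move=> Ms Mv; apply/eigenspaceP; rewrite -[X in _ *m X]Ms -trmx_mul Mv linearZ. Qed.

Lemma eigen_root M v (a : R) : M^T = M -> v != 0 -> M *m v = a *: v ->
  root (char_poly M) a.
Proof.
move=> Ms v0 Mv; rewrite -eigenvalue_root_char; apply/eigenvalueP.
exists v^T; first exact/eigenspaceP/eigen_row.
by rewrite trmx_eq0.
Qed.

Lemma root_eigen M (a : R) : M^T = M -> root (char_poly M) a ->
  exists2 v, unit_sphere v & M *m v = a *: v.
Proof.
move=> Ms; rewrite -eigenvalue_root_char => /eigenvalueP[u uM u0].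
have v0 : u^T != 0 by rewrite trmx_eq0.
exists ((Num.sqrt (dot u^T u^T))^-1 *: u^T); first exact: normalize.
by rewrite -scalemxAr -{1}Ms -trmx_mul uM linearZ /= !scalerA mulrC.
Qed.

(** The spectral theorem in the form needed here: the sum E of the eigenspaces
is everything. Otherwise the orthogonal complement of E, an invariant
subspace, contains an eigenvector by [rayleigh]; that eigenvector also lies in
E, hence is orthogonal to itself. *)
Lemma eigen_decomposition M (s : seq R) u : M^T = M ->
  (forall a, root (char_poly M) a -> a \in s) ->
  exists f : 'I_(size s) -> 'cV[R]_n,
    u = \sum_i f i /\ forall i, M *m f i = s`_i *: f i.
Proof.
move=> Ms sP; pose E := (\sum_(i < size s) eigenspace M s`_i)%MS.
have Estable : (E *m M <= E)%MS.
  rewrite sumsmxMr; apply/sumsmx_subP => i _; apply: (sumsmx_sup i) => //.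
  have /eigenspaceP -> := submx_refl (eigenspace M s`_i).
  exact: scalemx_sub.
have Efull : row_full E.
  rewrite -cokermx_eq0; apply: contraT => /matrix0Pn[i [j Cij]].
  have [||v [a [v1 Ev Mv _]]] := @rayleigh R n n M E Ms.
  - move=> w Ew; have /submxP[X EX] := Estable.
    by rewrite mulmxA EX -mulmxA Ew mulmx0.
  - exists (col j (cokermx E)).
      by apply/matrix0Pn; exists i, 0; rewrite mxE.
    by rewrite colE mulmxA mulmx_coker mul0mx.
  have v0 := unit_sphere_neq0 v1.
  have /sP sa := eigen_root Ms v0 Mv.
  have /submxP[X vX] : (v^T <= E)%MS.
    have lt_i : (index a s < size s)%N by rewrite index_mem.
    apply: (sumsmx_sup (Ordinal lt_i)) => //=.
    by rewrite nth_index //; exact: eigen_row.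
  by move: v0; rewrite -dot_eq0 /dot vX -mulmxA Ev mulmx0 mxE eqxx.
have /sub_sumsmxP[X uX] : (u^T <= E)%MS by exact: submx_full.
exists (fun i => (X i *m eigenspace M s`_i)^T); split.
  by rewrite -[u]trmxK uX linear_sum.
move=> i; rewrite -{1}Ms -trmx_mul -linearZ /=; congr trmx.
by apply/eigenspaceP; exact: submxMl.
Qed.

End Symmetric.

(** * Spectrum of a graph Laplacian with nonzero second eigenvalue *)

Section Laplacian.
Context (R : realType) (n : nat) (A : 'M[R]_n).
Hypotheses (A_sym : A^T = A) (A_ge0 : forall i j, 0 <= A i j).
Local Notation L := (laplacian A).
Local Notation one := (const_mx 1 : 'cV[R]_n).

Lemma laplacian_sym : L^T = L.
Proof. by rewrite /laplacian linearB /= tr_diag_mx A_sym. Qed.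

Lemma laplacian_mulE (v : 'cV[R]_n) i :
  (L *m v) i 0 = \sum_j A i j * (v i 0 - v j 0).
Proof.
rewrite /laplacian mulmxBl mxE mul_diag_mx !mxE big_distrl /= -sumrB.
by apply: eq_bigr => j _; rewrite mulrBr.
Qed.

Lemma laplacian_one : L *m one = 0.
Proof.
apply/matrixP => i j; rewrite ord1 laplacian_mulE [RHS]mxE big1 // => k _.
by rewrite !mxE subrr mulr0.
Qed.

(** Twice the form is the sum of the A i j (v i - v j)^2. *)
Lemma quad_laplacian_ge0 (v : 'cV[R]_n) : 0 <= quad L v.
Proof.
have qE : quad L v = \sum_i \sum_j A i j * (v i 0 - v j 0) * v i 0.
  rewrite quadE dotE; apply: eq_bigr => i _.
  by rewrite laplacian_mulE mulrC big_distrl.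
suff : 0 <= quad L v + quad L v by rewrite -mulr2n pmulrn_lge0.
rewrite {1}qE exchange_big qE -big_split sumr_ge0 // => i _ /=.
rewrite -big_split sumr_ge0 // => j _ /=.
have -> : A j i = A i j by rewrite -[in LHS]A_sym mxE.
rewrite (_ : _ + _ = A i j * (v i 0 - v j 0) ^+ 2); last by ring.
by rewrite mulr_ge0 // sqr_ge0.
Qed.

Hypothesis lam2_neq0 : lambda L 2 != 0.
Let s := spectrum L.

(** When the characteristic polynomial does not split, the spectrum is the
default value [::] and all the eigenvalues read off it are 0. A nonzero second
eigenvalue thus certifies the factorization. *)
Lemma spectrum_spec : sorted <=%R s /\ char_poly L = \prod_(a <- s) ('X - a%:P).
Proof.
move: lam2_neq0; rewrite /lambda /s /spectrum.
by case: xgetP => [t -> //|_]; rewrite eqxx.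
Qed.

Lemma root_spectrum (a : R) : root (char_poly L) a = (a \in s).
Proof. by have [_ ->] := spectrum_spec; exact: root_prod_XsubC. Qed.

Lemma size_spectrum : size s = n.
Proof.
by have := size_char_poly L; have [_ ->] := spectrum_spec; rewrite size_prod_XsubC => -[].
Qed.

Lemma lambda2E : lambda L 2 = s`_1. Proof. by []. Qed.

Lemma spectrum_size_gt1 : (1 < size s)%N.
Proof. by rewrite ltnNge; apply: contra lam2_neq0 => ?; rewrite lambda2E nth_default. Qed.

Lemma spectrum_le (i j : nat) : (i <= j)%N -> (j < size s)%N -> s`_i <= s`_j.
Proof.
move=> ij js; have [ss _] := spectrum_spec.
by apply: (sorted_leq_nth le_trans le_refl 0 ss) => //; rewrite inE (leq_ltn_trans ij).
Qed.

Lemma spectrum_ge0 (a : R) : a \in s -> 0 <= a.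
Proof.
rewrite -root_spectrum => /(root_eigen laplacian_sym)[v v1 Lv].
by rewrite -(quad_eigen v1 Lv) quad_laplacian_ge0.
Qed.

Lemma lambda2_gt0 : 0 < lambda L 2.
Proof.
rewrite lt_neqAle eq_sym lam2_neq0 spectrum_ge0 // mem_nth //.
exact: spectrum_size_gt1.
Qed.

Lemma one_neq0 : one != 0.
Proof.
have n0 : (0 < n)%N by rewrite -size_spectrum ltnW // spectrum_size_gt1.
by apply/matrix0Pn; exists (Ordinal n0), 0; rewrite mxE oner_eq0.
Qed.

Lemma spectrum0 : s`_0 = 0.
Proof.
have : 0 \in s.
  rewrite -root_spectrum; apply: (eigen_root laplacian_sym one_neq0).
  by rewrite laplacian_one scale0r.
move=> /(nthP 0)[i is_ si]; apply/eqP; rewrite eq_le; apply/andP; split.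
  by rewrite -[leRHS]si spectrum_le.
by rewrite spectrum_ge0 // mem_nth // ltnW // spectrum_size_gt1.
Qed.

(** If the kernel had dimension 2, then 0 would be a double root of the
characteristic polynomial, and the second eigenvalue would vanish. *)
Lemma laplacian_ker (w : 'cV[R]_n) : L *m w = 0 -> exists c : R, w = c *: one.
Proof.
move=> Lw; pose E := eigenspace L 0.
have subE (u : 'cV[R]_n) : L *m u = 0 -> (u^T <= E)%MS.
  by move=> Lu; apply: eigen_row; rewrite ?laplacian_sym // Lu scale0r.
have rE : (\rank E <= 1)%N.
  rewrite leqNgt; apply/negP => r2.
  have := geometric_le_algebraic_mult L 0; rewrite -/E.
  have [_ ->] := spectrum_spec; move: spectrum0 (lambda2E) lambda2_gt0.
  have := spectrum_le; have := spectrum_size_gt1.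
  case: s => [|a [|b t]] //= _ ble -> -> b0; rewrite big_cons.
  rewrite -(subnK r2) exprD => dv.
  have {dv} : ('X - 0%:P) ^+ 2 %| ('X - 0%:P) * \prod_(j <- b :: t) ('X - j%:P).
    exact: dvdp_trans (dvdp_mull _ (dvdpp _)) dv.
  rewrite expr2 dvdp_mul2l ?polyXsubC_eq0 // dvdp_XsubCl root_prod_XsubC.
  move=> /(nthP 0)[i it bi]; have := ble 1 i.+1 isT it.
  by rewrite /= bi leNgt b0.
have E1 : (E <= one^T)%MS.
  have /mxrank_leqif_sup/leqifP := subE _ laplacian_one.
  case: ifP => // _; rewrite mxrank_tr => /leq_trans/(_ rE).
  by rewrite ltnS leqn0 mxrank_eq0 (negbTE one_neq0).
have /sub_rVP[c wc] := submx_trans (subE _ Lw) E1.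
by exists c; apply: trmx_inj; rewrite wc linearZ.
Qed.

Lemma eigen_orth_one (v : 'cV[R]_n) (a : R) : a != 0 -> L *m v = a *: v ->
  one^T *m v = 0.
Proof.
move=> a0 Lv; apply: (scalerI a0); rewrite scaler0 scalemxAr -Lv mulmxA.
by rewrite -{1}laplacian_sym -trmx_mul laplacian_one trmx0 mul0mx.
Qed.

Lemma lambda2_eigenvector : exists v : 'cV[R]_n,
  [/\ unit_sphere v, one^T *m v = 0 & quad L v = lambda L 2].
Proof.
have [|v v1 Lv] := @root_eigen R n L (lambda L 2) laplacian_sym.
  by rewrite root_spectrum mem_nth // spectrum_size_gt1.
exists v; split => //; first exact: eigen_orth_one Lv.
exact: quad_eigen.
Qed.

(** The minimum of the form on the orthogonal complement of the all-ones
vector is an eigenvalue with an eigenvector in that complement, so it is not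
the simple eigenvalue 0 and is at least the second eigenvalue. *)
Lemma lambda2_le_quad (w : 'cV[R]_n) : unit_sphere w -> one^T *m w = 0 ->
  lambda L 2 <= quad L w.
Proof.
have [||v [a [v1 ov Lv amin]]] := @rayleigh R n 1 L one^T laplacian_sym.
- move=> u _; rewrite mulmxA -[L]laplacian_sym -trmx_mul laplacian_one trmx0.
  by rewrite mul0mx.
- have [v [v1 ov _]] := lambda2_eigenvector.
  by exists v => //; exact: unit_sphere_neq0.
move=> w1 ow; apply: le_trans (amin _ w1 ow).
have v0 := unit_sphere_neq0 v1.
have : a \in s by rewrite -root_spectrum; exact: eigen_root laplacian_sym v0 Lv.
move=> /(nthP 0)[[|i] si ai]; last by rewrite -ai; exact: spectrum_le.
(* an eigenvector of the least eigenvalue 0 is proportional to one, so it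
   cannot be orthogonal to it *)
have /laplacian_ker[c vc] : L *m v = 0 by rewrite Lv -ai spectrum0 scale0r.
by move: v0; rewrite -dot_eq0 {1}vc dotZl /dot ov mxE mulr0 eqxx.
Qed.

(** The indicator of the component of i is in the kernel, hence constant. *)
Lemma laplacian_connected : graph_connected A.
Proof.
move=> i j; apply: contraT => nij.
pose w : 'cV[R]_n := \col_k (connect [rel a b | 0 < A a b] i k)%:R.
have /laplacian_ker[c wc] : L *m w = 0.
  apply/matrixP => k z; rewrite ord1 laplacian_mulE [RHS]mxE big1 // => l _.
  rewrite !mxE; have [->|Akl] := eqVneq (A k l) 0; first by rewrite mul0r.
  have Akl0 : 0 < A k l by rewrite lt_neqAle eq_sym Akl A_ge0.
  have Alk0 : 0 < A l k by rewrite -[A]A_sym mxE.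
  suff -> : connect [rel a b | 0 < A a b] i k = connect [rel a b | 0 < A a b] i l.
    by rewrite subrr mulr0.
  by apply/idP/idP => h; apply: connect_trans h _; exact: connect1.
have := congr1 (fun u : 'cV[R]_n => u i 0) wc.
have := congr1 (fun u : 'cV[R]_n => u j 0) wc.
rewrite !mxE (negbTE nij) connect0 mulr1 => <- /eqP.
by rewrite oner_eq0.
Qed.

End Laplacian.

(** The eigenvalues numbered 2 to n are positive, so their eigenvectors are
orthogonal to the all-ones vector. Conversely, the component along the
eigenvalue 0 of a vector of that orthogonal complement is proportional and
orthogonal to the all-ones vector, hence zero. *)
Lemma VI_connected (R : realType) (n N : nat) (A : 'cV[R]_N -> 'M[R]_n)
    (x : 'cV[R]_N) : (A x)^T = A x -> (forall i j, 0 <= A x i j) ->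
  lam A 2 x != 0 ->
  VI A [set p | (2 <= p <= n)%N] x =
    [set v : 'cV[R]_n | unit_sphere v /\ (const_mx 1 : 'cV[R]_n)^T *m v = 0].
Proof.
move=> As A0 lam2_neq0; have Ls := laplacian_sym As.
have sz := size_spectrum lam2_neq0.
apply/seteqP; split => v [].
  move=> [m [c [w [wV ->]]]] v1; split => //.
  rewrite mulmx_sumr big1 // => i _; rewrite -scalemxAr.
  have [p /= /andP[p2 pn] [_ Lw]] := wV i.
  rewrite (eigen_orth_one As _ Lw) ?scaler0 // gt_eqF //.
  apply: lt_le_trans (lambda2_gt0 As A0 lam2_neq0) _.
  apply: (spectrum_le lam2_neq0); rewrite -/(Lap A x) ?sz; case: p p2 pn {Lw} => //=.
move=> v1 ov; split => //.
have [a|f [vf Lf]] := @eigen_decomposition R n (Lap A x) (spectrum (Lap A x)) v Ls.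
  by rewrite root_spectrum.
have s_gt0 : (0 < size (spectrum (Lap A x)))%N.
  by rewrite ltnW // (spectrum_size_gt1 lam2_neq0).
have f0 : f (Ordinal s_gt0) = 0.
  have := Lf (Ordinal s_gt0); rewrite /= (spectrum0 As A0 lam2_neq0) scale0r.
  move=> /(laplacian_ker As A0 lam2_neq0)[c fc].
  have : (const_mx 1 : 'cV[R]_n)^T *m f (Ordinal s_gt0) = 0.
    move: ov; rewrite vf mulmx_sumr (bigD1 (Ordinal s_gt0)) //= big1 ?addr0 //.
    move=> i i0; apply: (eigen_orth_one As _ (Lf i)).
    rewrite gt_eqF // (lt_le_trans (lambda2_gt0 As A0 lam2_neq0)) //.
    apply: (spectrum_le lam2_neq0) => //.
    by rewrite lt0n; apply: contra i0 => /eqP i0; apply/eqP/val_inj.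
  rewrite fc -scalemxAr => /(congr1 (fun M : 'M[R]_1 => M 0 0)).
  rewrite mxE -/(dot _ _) mxE => /eqP; rewrite mulf_eq0 dot_eq0.
  by rewrite (negbTE (one_neq0 lam2_neq0)) orbF => /eqP ->; rewrite scale0r.
have v21 : exists2 v2 : 'cV[R]_n, unit_sphere v2 & Lap A x *m v2 = lam A 2 x *: v2.
  by apply: root_eigen => //; rewrite root_spectrum // mem_nth // spectrum_size_gt1.
have [v2 v21n Lv2] := v21.
pose nrm i := Num.sqrt (dot (f i) (f i)).
(* a vanishing component gets coefficient 0 and, as its direction, an
   arbitrary admissible vector *)
exists (size (spectrum (Lap A x))), nrm,
  (fun i => if f i == 0 then v2 else (nrm i)^-1 *: f i).
split=> [i|]; last first.
  rewrite vf; apply: eq_bigr => i _; rewrite /nrm.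
  case: ifPn => [/eqP ->|fi]; first by rewrite dot0r sqrtr0 scale0r.
  rewrite scalerA divff ?scale1r // gt_eqF // sqrtr_gt0 lt_neqAle eq_sym.
  by rewrite dot_eq0 fi dot_ge0.
case: ifPn => [_|fi]; first by exists 2%N => //=; rewrite -sz (spectrum_size_gt1 lam2_neq0).
have i0 : (0 < i)%N.
  rewrite lt0n; apply: contra fi => /eqP i0.
  by rewrite -f0; apply/eqP; congr f; exact: val_inj.
exists i.+1; first by rewrite /= ltnS i0 /=; apply: leq_trans (ltn_ord i) _; rewrite sz.
split; first exact: normalize.
by rewrite -scalemxAr Lf !scalerA mulrC.
Qed.

(** * Monotonicity from the sign of the derivative almost everywhere *)

Section Monotone.
Context (R : realType).
Local Notation mu := (@lebesgue_measure R).

Lemma sum_length_le_measure (U : set R) (m : nat) (s t : 'I_m -> R) :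
  open U -> (forall i, s i <= t i) -> (forall i, `]s i, t i[%classic `<=` U) ->
  (forall i j, i != j -> t i <= s j \/ t j <= s i) ->
  ((\sum_i (t i - s i))%:E <= mu U)%E.
Proof.
move=> Uo st stU dis.
have len i : (t i - s i)%:E = mu `]s i, t i[%classic.
  rewrite lebesgue_measure_itv /= lte_fin.
  case: ltP => // ts; have /eqP : t i - s i == 0 by rewrite subr_eq0 eq_le ts st.
  by move=> ->.
rewrite -sumEFin; under eq_bigr do rewrite len.
have TE : [set` index_enum 'I_m] = [set: 'I_m].
  by apply/seteqP; split => // i _; rewrite /= mem_index_enum.
rewrite (fsbig_seq _ _ (index_enum_uniq _)) TE -measure_fin_bigcup //.
- apply: le_measure; rewrite ?inE; last by move=> z [i _]; exact: stU.
  + by apply: fin_bigcup_measurable; [exact: finite_finset|] => i _; exact: measurable_itv.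
  + exact: measurable_realfun.open_measurable.
- exact: finite_finset.
- move=> i j _ _ [z /= []]; rewrite !in_itv /= => /andP[siz zti] /andP[sjz ztj].
  apply: contrapT => /eqP /dis[h|h].
    by move: (lt_trans sjz zti); rewrite ltNge h.
  by move: (lt_trans siz ztj); rewrite ltNge h.
Qed.

Section Variation.
Context (V : normedModType R) (x : R -> V) (a : R) (U : set R).

(** The variation of x over families of nonoverlapping intervals of [a, t]
whose interiors lie in U. For U open of small measure around a null set, it
bounds all that x can do on the null set. *)
Definition covered_sums (t : R) : set R :=
  [set r | exists (m : nat) (p q : 'I_m -> R),
    [/\ forall i, [/\ a <= p i, p i <= q i & q i <= t],
        forall i j, i != j -> q i <= p j \/ q j <= p i,
        forall i, `]p i, q i[%classic `<=` U &
        r = \sum_i `|x (q i) - x (p i)|]].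

Definition covered_variation (t : R) : R := sup (covered_sums t).

Lemma covered_sums0 t : covered_sums t 0.
Proof. by exists 0, (fun=> 0), (fun=> 0); split=> [[]|[]|[]|] //; rewrite big_ord0. Qed.

Lemma covered_sums_step t t' r : a <= t -> t <= t' -> `]t, t'[%classic `<=` U ->
  covered_sums t r -> covered_sums t' (r + `|x t' - x t|).
Proof.
move=> at_ tt' tU [m [p [q [pq dis pqU ->]]]].
pose ext (f : 'I_m -> R) (c : R) (i : 'I_m.+1) :=
  if unlift ord_max i is Some j then f j else c.
have extL f c j : ext f c (lift ord_max j) = f j by rewrite /ext liftK.
have extM f c : ext f c ord_max = c by rewrite /ext unlift_none.
exists m.+1, (ext p t), (ext q t'); split.
- move=> i; have [j ->|->] := unliftP ord_max i; last by rewrite !extM.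
  by rewrite !extL; have [? ? qt] := pq j; split => //; exact: le_trans tt'.
- move=> i j; have [i' ->|->] := unliftP ord_max i; have [j' ->|->] := unliftP ord_max j.
  + by rewrite !extL => /eqP ij; apply: dis; apply/eqP => ij'; apply: ij; rewrite ij'.
  + by rewrite !extL !extM => _; left; have [] := pq i'.
  + by rewrite !extL !extM => _; right; have [] := pq j'.
  + by rewrite eqxx.
- by move=> i; have [j ->|->] := unliftP ord_max i; rewrite ?extL ?extM.
rewrite big_ord_recr /= !extM; congr (_ + _); apply: eq_bigr => i _.
have -> : widen_ord (leqnSn m) i = lift ord_max i.
  by apply: val_inj; rewrite /= /bump leqNgt ltn_ord.
by rewrite !extL.
Qed.

Context (b e : R).
Hypothesis sums_le : forall r, covered_sums b r -> r <= e.

Lemma covered_sums_le t t' : t <= t' -> covered_sums t `<=` covered_sums t'.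
Proof.
move=> tt' r [m [p [q [pq dis pqU ->]]]]; exists m, p, q; split => // i.
by have [? ? qt] := pq i; split => //; exact: le_trans tt'.
Qed.

Lemma covered_sums_ub t : t <= b -> has_ubound (covered_sums t).
Proof. by move=> tb; exists e => r /(covered_sums_le tb); exact: sums_le. Qed.

Lemma covered_variation_ge0 t : t <= b -> 0 <= covered_variation t.
Proof. by move=> tb; apply: ub_le_sup; [exact: covered_sums_ub|exact: covered_sums0]. Qed.

Lemma covered_variation_le t : t <= b -> covered_variation t <= e.
Proof.
move=> tb; apply: ge_sup; first by exists 0; exact: covered_sums0.
by move=> r /(covered_sums_le tb); exact: sums_le.
Qed.

Lemma covered_variation_homo t t' : t <= t' -> t' <= b ->
  covered_variation t <= covered_variation t'.
Proof.
move=> tt' t'b; apply: ge_sup; first by exists 0; exact: covered_sums0.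
by move=> r /(covered_sums_le tt'); exact/ub_le_sup/covered_sums_ub.
Qed.

Lemma covered_variation_step t t' : a <= t -> t <= t' -> t' <= b ->
  `]t, t'[%classic `<=` U ->
  covered_variation t + `|x t' - x t| <= covered_variation t'.
Proof.
move=> at_ tt' t'b tU; rewrite -lerBrDr; apply: ge_sup.
  by exists 0; exact: covered_sums0.
move=> r /(covered_sums_step at_ tt' tU) h; rewrite lerBrDr.
by apply: ub_le_sup h; exact: covered_sums_ub.
Qed.

End Variation.

(** Continuous induction on the set of t with g a <= g t: its supremum belongs
to it by the first hypothesis, and equals b by the second. *)
Lemma continuous_induction_le (g : R -> R) (a b : R) : a <= b ->
  (forall t, a < t -> t <= b -> forall e, 0 < e ->
     \forall s \near t^'-, a <= s -> g s <= g t + e) ->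
  (forall t, a <= t -> t < b -> \forall s \near t^'+, s <= b -> g t <= g s) ->
  g a <= g b.
Proof.
move=> ab gl gr; pose S := [set t | a <= t <= b /\ g a <= g t].
have Sa : S a by rewrite /S /= lexx ab.
have Sub : has_ubound S by exists b => t [/andP[]].
set c := sup S.
have ac : a <= c by exact: ub_le_sup.
have cb : c <= b by apply: ge_sup; [exists a|move=> t [/andP[]]].
have gc : g a <= g c.
  have [->//|ac'] := eqVneq c a.
  apply/ler_addgt0Pr => e e0.
  have := gl c _ cb e e0; rewrite lt_neqAle eq_sym ac' ac => /(_ isT).
  rewrite near_withinE => /nbhs_ballP[d /= d0 H].
  have [s [/andP[as_ sb] gs] cs] : exists2 s, S s & c - d < s.
    by apply: sup_adherent => //; split => //; exists a.
  have [->|sc] := eqVneq c s; first by rewrite (le_trans gs) // lerDl ltW.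
  have sc' : s <= c by apply: ub_le_sup => //; split => //; rewrite as_.
  apply: (le_trans gs); apply: H => //; last by rewrite lt_neqAle eq_sym sc.
  by rewrite /ball /= ger0_norm ?subr_ge0 // ltrBlDr addrC -ltrBlDr.
have [->//|cb'] := eqVneq b c.
have cltb : c < b by rewrite lt_neqAle eq_sym cb'.
have : \forall s \near c^'+, (s <= b -> g c <= g s) /\ (c < s /\ s < b).
  near=> s; split; first by near: s; exact: gr.
  by split; near: s; [exact: nbhs_right_gt|exact: nbhs_right_lt].
move=> /filter_ex[s [gs [cs sb]]].
have Ss : S s.
  by split; [rewrite (le_trans ac (ltW cs)) ltW|rewrite (le_trans gc) // gs // ltW].
by have := ub_le_sup Sub Ss; rewrite -/c leNgt cs.
Unshelve. all: by end_near. Qed.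

(** The exceptional null set is covered by an open set U so small that the
variation F of x inside U is at most e. The function
phi t + e (t - a) + C (F t) is then locally nondecreasing to the right of
every t: at t in U because F increases by at least |x s - x t|, which absorbs
a possible decrease of phi, and at other t because of the bound on the
derivative of phi. By continuous induction its value at b is at least
its value at a; then let e tend to 0. The comparison of phi with x through C
is the form in which absolute continuity enters when phi is a differentiable
function of the path x. *)
Lemma ae_nondecreasing (V : normedModType R) (x : R -> V) (phi : R -> R)
    (a b C : R) : a <= b -> 0 <= C -> abs_continuous a b x ->
  (forall t, a < t -> t <= b -> forall e, 0 < e ->
     \forall s \near t^'-, a <= s -> phi s <= phi t + e) ->
  (forall t, a <= t -> t < b ->
     \forall s \near t^'+, s <= b -> phi t - phi s <= C * `|x s - x t|) ->
  {ae mu, forall t, a <= t -> t < b -> forall e, 0 < e ->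
     \forall s \near t^'+, s <= b -> phi t - phi s <= e * (s - t)} ->
  phi a <= phi b.
Proof.
move=> ab C0 xac phil phiC phid.
apply/ler_addgt0Pr => e0 e0_gt0.
(* e (b - a) + C e, the total error of the correction terms, is below e0 *)
pose e := e0 / (b - a + C + 1).
have den : 0 < b - a + C + 1 by rewrite ltr_wpDl // addr_ge0 // subr_ge0.
have e_gt0 : 0 < e by rewrite divr_gt0.
have [d d0 xd] := xac e e_gt0.
move/negligible_outer_measure : phid; set Z := (Z in _ Z = 0) => Z0.
have d2 : 0 < d / 2 by rewrite divr_gt0.
have [U [Uo ZU]] := outer_measure_open_le Z d2; rewrite Z0 add0e => Ud.
have sums_le r : covered_sums x a U b r -> r <= e.
  move=> [m [p [q [pq dis pqU ->]]]]; apply/ltW/xd => //.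
  rewrite -lte_fin (le_lt_trans (sum_length_le_measure Uo _ pqU dis)) //.
    by move=> i; have [] := pq i.
  by rewrite (le_lt_trans Ud) // lte_fin ltr_pdivrMr // ltr_pMr // ltr1n.
pose F := covered_variation x a U.
have Fhomo t t' : t <= t' -> t' <= b -> F t <= F t' by exact: (covered_variation_homo sums_le).
pose g t := phi t + e * (t - a) + C * F t.
have : g a <= g b.
  apply: continuous_induction_le => // t at_ tb.
    move=> h h0; have := phil t at_ tb h h0; apply: filterS2 (nbhs_left_lt t) => s st + as_.
    move=> /(_ as_) ps; have Fs := Fhomo _ _ (ltW st) tb.
    have := ler_wpM2l C0 Fs; have := ler_wpM2l (ltW e_gt0) (ltW st).
    by rewrite /g; lra.
  have [tU|tU] := pselect (U t).
    have : \forall s \near t^'+, `]t, s[%classic `<=` U.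
      have /nbhs_ballP[r /= r0 rU] := open_nbhs_nbhs (conj Uo tU).
      near=> s => z /=; rewrite in_itv /= => /andP[tz zs]; apply: rU.
      rewrite /ball /= ltr0_norm ?subr_lt0 // opprB ltrBlDl (lt_trans zs) //.
      by near: s; apply: nbhs_right_lt; rewrite ltrDl.
    apply: filterS3 (nbhs_right_gt t) (phiC t at_ tb) => s ts pC tsU sb.
    have := ler_wpM2l C0 (covered_variation_step sums_le at_ (ltW ts) sb tsU).
    have := ler_wpM2l (ltW e_gt0) (ltW ts); have := pC sb.
    by rewrite mulrDr /g /F; lra.
  have := contra_not (ZU t) tU; rewrite /= notK => /(_ at_ tb e e_gt0).
  apply: filterS2 (nbhs_right_gt t) => s ts pe sb.
  have := ler_wpM2l C0 (Fhomo _ _ (ltW ts) sb); have := pe sb.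
  by rewrite /g; lra.
have Fb : F b <= e by exact: (covered_variation_le sums_le).
have Fa : 0 <= F a by exact: (covered_variation_ge0 sums_le).
have CFb := ler_wpM2l C0 Fb; have CFa := mulr_ge0 C0 Fa.
have -> : e0 = e * (b - a + C + 1) by rewrite /e divfK // gt_eqF.
by rewrite /g; lra.
Unshelve. all: by end_near. Qed.

End Monotone.

(** * Continuity of the minimizer of a parametric convex program *)

Section Argmin.
Context (R : realType).

Lemma strictly_convex_le (V : lmodType R) (f : V -> R) (u v : V) (t : R) :
  strictly_convex f -> 0 <= t <= 1 ->
  f (t *: u + (1 - t) *: v) <= t * f u + (1 - t) * f v.
Proof.
move=> fc /andP[t0 t1]; have [->|uv] := eqVneq u v.
  by rewrite -scalerDl -mulrDl addrC subrK scale1r mul1r.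
have [->|t0'] := eqVneq t 0; first by rewrite scale0r mul0r subr0 scale1r mul1r !add0r.
have [->|t1'] := eqVneq t 1.
  by rewrite subrr scale0r mul0r scale1r mul1r !addr0.
by apply/ltW/fc => //; rewrite lt_neqAle eq_sym t0' t0 lt_neqAle t1' t1.
Qed.

Lemma argmin_lt (V : lmodType R) (U : set V) (f : V -> R) (k u : V) :
  (forall u v t, U u -> U v -> 0 <= t <= 1 -> U (t *: u + (1 - t) *: v)) ->
  strictly_convex f -> argmin U f k -> U u -> u != k -> f k < f u.
Proof.
move=> Uc fc [Uk kmin] Uu uk; rewrite ltNge; apply/negP => uk'.
have h01 : 0 < (1 / 2 : R) < 1 by apply/andP; split; lra.
have Um : U ((1 / 2) *: u + (1 - 1 / 2) *: k).
  by apply: Uc => //; case/andP: h01 => /ltW -> /ltW ->.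
have := le_lt_trans (kmin _ Um) (fc u k (1 / 2) uk h01); have := kmin _ Uu.
by move: uk'; lra.
Qed.

Lemma compact_sphere (N : nat) (c : 'cV[R]_N) (e : R) :
  compact [set u : 'cV[R]_N | `|u - c| = e].
Proof.
apply: compact_cV.
  exists (e + `|c|); split; first exact: num_real.
  move=> y ye v /= ve; apply: le_trans (ltW ye).
  by rewrite -[v](subrK c) (le_trans (ler_normD _ _)) // ve.
apply: (@preimage_closed _ _ (fun u : 'cV[R]_N => `|u - c|) [set r | r = e]).
  move=> v _; apply: (@continuous_comp _ _ _ (fun u : 'cV[R]_N => u - c) Num.norm).
    by apply: continuousB; [exact: cvg_id|exact: cst_continuous].
  exact: norm_continuous.
exact: closed_eq.
Qed.

(** Fix a radius e around the minimizer k0 at x0. On the sphere of that radius,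
the feasible points cost more than the minimum by some c > 0, uniformly for x
near x0 (compactness and closed graph). A point ut of the segment from k0 to a
Slater point, chosen close to k0, stays feasible for x near x0 and costs less
than the minimum plus c. If the minimizer at x were outside the sphere, the
segment from it to ut would cross the sphere at a feasible point, whose cost,
by convexity, would be at most that of ut: a contradiction. *)
Lemma continuous_argmin (T : topologicalType) (N : nat)
    (U : T -> set 'cV[R]_N) (J : T * 'cV[R]_N -> R) (k : T -> 'cV[R]_N) :
  continuous J -> (forall x, strictly_convex (fun u => J (x, u))) ->
  (forall x u v t, U x u -> U x v -> 0 <= t <= 1 -> U x (t *: u + (1 - t) *: v)) ->
  (forall x u, ~ U x u -> \forall p \near (x, u), ~ U p.1 p.2) ->
  (forall x, exists w, forall u t, U x u -> 0 < t <= 1 ->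
     \forall y \near x, U y (t *: w + (1 - t) *: u)) ->
  (forall x, argmin (U x) (fun u => J (x, u)) (k x)) ->
  continuous k.
Proof.
move=> Jc Jconv Uconv Uclosed Uslater kmin x0; set k0 := k x0.
apply/cvgrPdist_lt => e e0.
pose S := [set u : 'cV[R]_N | `|u - k0| = e].
(* the sphere of radius e carries a uniform gap c between the optimal value
   and the cost of feasible points *)
have cov := (compact_near_coveringP S).1 (@compact_sphere N k0 e).
have gap : \forall y \near filter_prod (nbhs x0) (0^'+ : set_system R),
    S `<=` (fun u => U y.1 u -> J (x0, k0) + y.2 < J (y.1, u)).
  apply: cov => u Su.
  have [Uu|/Uclosed [[P Q] [/= nP nQ] PQ]] := pselect (U x0 u); last first.
    exists (Q, [set y | P y.1]); first split => //=.
      by exists (P, setT) => //=; [split => //; exact: filterT|move=> ? []].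
    move=> [u' [y c]] [/= Qu' Py] Uy.
    by have := PQ (y, u') (conj Py Qu').
  have uk0 : u != k0.
    apply: contra_eqN Su => /eqP ->.
    by rewrite subrr normr0 lt_eqF.
  have := argmin_lt (@Uconv x0) (Jconv x0) (kmin x0) Uu uk0.
  rewrite -/k0 -subr_gt0 => gap0; set g := J (x0, u) - J (x0, k0) in gap0.
  have g2 : 0 < g / 2 by rewrite divr_gt0.
  have := (cvgrPdist_lt _ _).1 (Jc (x0, u)) _ g2 => -[[P Q] [/= nP nQ] PQ].
  exists (Q, [set y | P y.1 /\ y.2 < g / 2]); first split => //=.
    exists (P, [set c | c < g / 2]) => //=; split => //.
    exact: nbhs_right_lt.
  move=> [u' [y c]] [/= Qu' [Py cg]] Uy.
  have := PQ (y, u') (conj Py Qu'); rewrite /= ltr_norml => /andP[_].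
  by move: cg; rewrite /g; lra.
case: gap => -[P Q] [/= nP nQ] PQ.
have [c [Qc c0]] : exists c, Q c /\ 0 < c.
  by apply: (@filter_ex _ (0^'+ : set_system R)); apply: filterI => //; exact: nbhs_right_gt.
have {PQ nQ Qc}gap y u : P y -> S u -> U y u -> J (x0, k0) + c < J (y, u).
  by move=> Py Su; apply: (PQ (y, c) (conj Py Qc) u Su).
have [w wS] := Uslater x0.
pose ut (t : R) := t *: w + (1 - t) *: k0.
have ut0 : ut t @[t --> 0^'+] --> k0.
  have -> : k0 = 0 *: w + (1 - 0) *: k0 by rewrite scale0r subr0 scale1r add0r.
  apply: cvg_at_right_filter; apply: cvgD; apply: cvgZr_tmp.
    exact: cvg_id.
  by apply: cvgB; [exact: cvg_cst|exact: cvg_id].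
have [t [t01 [ute Jut]]] : exists t : R, 0 < t <= 1 /\
    (`|ut t - k0| < e /\ J (x0, ut t) < J (x0, k0) + c).
  apply: (@filter_ex _ (0^'+ : set_system R)); near=> t; split.
    by apply/andP; split; near: t; [exact: nbhs_right_gt|exact: (nbhs_right_le ltr01)].
  split; near: t.
    by apply: filterS ((cvgrPdist_lt _ _).1 ut0 _ e0) => s; rewrite distrC.
  have Jt : J (x0, ut t) @[t --> 0^'+] --> J (x0, k0).
    apply: (@cvg_comp _ _ _ (fun t => (x0, ut t)) J _ (nbhs (x0, k0))) (Jc (x0, k0)).
    exact: (@cvg_pair _ _ _ _ (nbhs x0) (nbhs k0) _ _ _ (fun=> x0) ut (cvg_cst _) ut0).
  apply: filterS ((cvgrPdist_lt _ _).1 Jt _ c0) => s.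
  by rewrite ltr_norml => /andP[+ _]; lra.
have Uut : \forall y \near x0, U y (ut t) by apply: wS => //; have [] := kmin x0.
have Jut' : \forall y \near x0, J (y, ut t) < J (x0, k0) + c.
  have Jy : J (y, ut t) @[y --> x0] --> J (x0, ut t).
    apply: (@cvg_comp _ _ _ (fun y => (y, ut t)) J _ (nbhs (x0, ut t))) (Jc (x0, ut t)).
    exact: (@cvg_pair _ _ _ _ (nbhs x0) (nbhs (ut t)) _ _ _ id (fun=> ut t) cvg_id (cvg_cst _)).
  have := Jut; rewrite -subr_gt0 => h; apply: filterS ((cvgrPdist_lt _ _).1 Jy _ h) => y.
  by rewrite ltr_norml => /andP[+ _]; lra.
apply: filterS3 nP Uut Jut' => y Py Uy Jy; rewrite distrC ltNge; apply/negP => ke.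
pose z (s : R) := s *: k y + (1 - s) *: ut t.
have zc : continuous (fun s => `|z s - k0|).
  move=> s; apply: (@continuous_comp _ _ _ (fun s => z s - k0) Num.norm).
    apply: cvgB; last exact: cvg_cst.
    apply: cvgD; apply: cvgZr_tmp; first exact: cvg_id.
    by apply: cvgB; [exact: cvg_cst|exact: cvg_id].
  exact: norm_continuous.
have [||s s01 zs] := @IVT _ (fun s => `|z s - k0|) 0 1 e ler01.
- exact: continuous_subspaceT.
- rewrite /z scale0r add0r subr0 scale1r scale1r subrr scale0r addr0.
  by rewrite ge_min le_max (ltW ute) ke orbT.
move: s01; rewrite in_itv /= => s01.
have [Uk kJ] := kmin y.
have Uz : U y (z s) by exact: Uconv.
have := gap y (z s) Py zs Uz.
have := strictly_convex_le (k y) (ut t) (Jconv y) s01.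
have := kJ _ Uy; rewrite -/(z s) /=; case/andP: s01 => s0 s1.
move: (J (y, k y)) (J (y, ut t)) (J (y, z s)) (J (x0, k0)) Jy => a b d f.
by move=> *; nra.
Unshelve. all: by end_near. Qed.
End Argmin.

(** * The Laplacian as a differentiable function of the state *)

Section Estimates.
Context (R : realType).

(** Definition of the differential without the little-o notation. *)
Lemma diff_estimate (V W : normedModType R) (f : V -> W) (x : V) (e : R) :
  differentiable f x -> 0 < e ->
  \forall y \near x, `|f y - f x - 'd f x (y - x)| <= e * `|y - x|.
Proof.
move=> /diff_locally/eqaddoP/(_ e) df e0.
have yx : y - x @[y --> x] --> (0 : V).
  by rewrite -(subrr x); apply: cvgB; [exact: cvg_id|exact: cvg_cst].
have := yx _ (df e0); rewrite /= nbhs_nearE near_map.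
apply: filterS => y /=.
by rewrite !fctE /= subrK opprD addrA.
Qed.

End Estimates.

Section Network.
Context (R : realType) (n N : nat).

Lemma laplacian_is_linear : linear (@laplacian R n).
Proof.
move=> c A B; apply/matrixP => i j; rewrite !mxE.
have -> : \sum_j0 (c *: A + B) i j0 = c * (\sum_j0 A i j0) + \sum_j0 B i j0.
  by rewrite mulr_sumr -big_split; apply: eq_bigr => k _; rewrite !mxE.
by case: eqP => _; rewrite ?mulr1n ?mulr0n; ring.
Qed.

HB.instance Definition _ :=
  GRing.isLinear.Build R 'M[R]_n 'M[R]_n _ (@laplacian R n) laplacian_is_linear.

Lemma quad_is_linear (v : 'cV[R]_n) : linear_for *%R (fun M : 'M[R]_n => quad M v).
Proof. by move=> c A B; rewrite /quad mulmxDr mulmxDl -scalemxAr -scalemxAl !mxE. Qed.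

Lemma continuous_laplacian : continuous (@laplacian R n).
Proof.
apply: continuous_mx => i j.
rewrite (_ : (fun B => _) = (fun B : 'M[R]_n => (i == j)%:R * (\sum_k B i k) - B i j)).
  have cs : continuous (fun B : 'M[R]_n => \sum_k B i k).
    by apply: (@continuous_sum R _ _ (fun k (B : 'M[R]_n) => B i k)) => k; exact: coord_continuous.
  have cm : continuous (fun B : 'M[R]_n => (i == j)%:R * \sum_k B i k).
    by apply: continuous_mul => //; exact: cst_continuous.
  exact: continuous_sub cm (@coord_continuous _ _ _ i j).
by apply/funext => B; rewrite !mxE mulr_natl.
Qed.

Context (A : 'cV[R]_N -> 'M[R]_n).
Hypothesis A_C1 : continuously_differentiable A.

Lemma Lap_differentiable x : differentiable (Lap A) x.
Proof.
apply: differentiable_comp; first exact: A_C1.1.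
by apply: linear_differentiable; exact: continuous_laplacian.
Qed.

Lemma diff_Lap x u : 'd (Lap A) x u = laplacian ('d A x u).
Proof.
have lc : continuous (@laplacian R n) := continuous_laplacian.
have := diff_comp (A_C1.1 x) (linear_differentiable (A x) lc).
rewrite (diff_lin (A x) lc) => /(congr1 (@^~ u)) /= <-.
by [].
Qed.

Lemma derive_Lap x u : 'D_u (Lap A) x = laplacian ('d A x u).
Proof. by rewrite -diff_Lap; apply: deriveE; exact: Lap_differentiable. Qed.

Lemma Lap_dotE x u : Lap_dot A x u = laplacian ('d A x u).
Proof.
rewrite [in RHS](matrix_sum_delta u) !linear_sum /Lap_dot.
by apply: eq_bigr => i _; rewrite big_ord1 !linearZ /= derive_Lap.
Qed.

Lemma continuous_Lap : continuous (Lap A).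
Proof. by move=> x; apply: differentiable_continuous; exact: Lap_differentiable. Qed.

Lemma continuous_Lap_dot : continuous (fun p : 'cV[R]_N * 'cV[R]_N => Lap_dot A p.1 p.2).
Proof.
apply: continuous_mx => a b.
rewrite (_ : (fun p => _) = (fun p : 'cV[R]_N * 'cV[R]_N =>
    \sum_i p.2 i 0 * (laplacian ('d A (p.1) (delta_mx i 0))) a b)).
  apply: continuous_sum => i; apply: continuous_mul.
    by apply: continuous_entry => p; exact: cvg_snd.
  apply: continuous_entry => p.
  apply: (@continuous_comp _ _ _ fst (fun x => laplacian ('d A x (delta_mx i 0)))).
    exact: cvg_fst.
  apply: (@continuous_comp _ _ _ (fun x => 'd A x (delta_mx i 0)) (@laplacian R n)).
    exact: A_C1.2.
  exact: continuous_laplacian.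
apply/funext => p; rewrite /Lap_dot summxE; apply: eq_bigr => i _.
by rewrite mxE derive_Lap.
Qed.

Lemma Lap_dot_conv x u v (t : R) :
  Lap_dot A x (t *: u + (1 - t) *: v) = t *: Lap_dot A x u + (1 - t) *: Lap_dot A x v.
Proof. by rewrite !Lap_dotE linearP linearZ /= linearP linearZ. Qed.

Lemma quad_Lap_diff x v : differentiable (fun y => quad (Lap A y) v) x /\
  forall u, 'd (fun y => quad (Lap A y) v) x u = quad (Lap_dot A x u) v.
Proof.
pose q := GRing.isLinear.Build _ _ _ _ _ (@quad_is_linear v).
pose ql : {linear 'M[R]_n -> R^o} := HB.pack (fun M : 'M[R]_n => quad M v : R^o) q.
have qc : continuous ql.
  apply: (@continuous_quad _ _ _ id (fun=> v)); last exact: cst_continuous.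
  by move=> ?; exact: cvg_id.
have dL := Lap_differentiable x.
have dq : differentiable ql (Lap A x) by exact: linear_differentiable.
split; first exact: (differentiable_comp dL dq).
move=> u; have := diff_comp dL dq.
by rewrite (diff_lin _ qc) => /(congr1 (@^~ u)) /= ->; rewrite diff_Lap Lap_dotE.
Qed.

End Network.

(** * Minima over a compact set *)

Section Minimum.
Context (R : realType).

Lemma compact_near_lt (T X : topologicalType) (K : set X) (f : T * X -> R)
    (c : T -> R) (x0 : T) : compact K -> continuous f -> continuous c ->
  (forall v, K v -> c x0 < f (x0, v)) ->
  \forall x \near x0, forall v, K v -> c x < f (x, v).
Proof.
move=> Kc fc cc cf.
have cov := (compact_near_coveringP K).1 Kc.
apply: (cov T (nbhs x0) (fun x v => c x < f (x, v))) => v Kv.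
have gc : continuous (fun p : X * T => f (p.2, p.1) - c p.2).
  apply: continuous_sub => [p|p]; last first.
    by apply: (@continuous_comp _ _ _ snd c); [exact: cvg_snd|exact: cc].
  apply: (@continuous_comp _ _ _ (fun p : X * T => (p.2, p.1)) f); last exact: fc.
  exact: (@cvg_pair _ _ _ _ (nbhs p.2) (nbhs p.1) _ _ _ snd fst cvg_snd cvg_fst).
have g0 : 0 < f (x0, v) - c x0 by rewrite subr_gt0 cf.
apply: filterS ((cvgrPdist_lt _ _).1 (gc (v, x0)) _ g0) => -[w x] /=.
by rewrite ltr_norml => /andP[_]; lra.
Qed.

Lemma minimum_image (X : topologicalType) (K : set X) (f : X -> R) :
  compact K -> K !=set0 -> continuous f ->
  exists v, [/\ K v, minimum [set f w | w in K] = f v & forall w, K w -> f v <= f w].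
Proof.
move=> Kc K0 fc.
have [v] := compact_EVT_min K0 Kc (continuous_subspaceT fc).
rewrite inE => Kv vmin.
have {}vmin w : K w -> f v <= f w by move=> Kw; apply: vmin; rewrite inE.
exists v; split => //; rewrite /minimum.
case: xgetP => [m -> [[w Kw <-] lb]|/(_ (f v)) []].
  by apply/eqP; rewrite eq_le vmin // andbT; apply: lb; exists v.
by split; [exists v|move=> _ [w Kw <-]; exact: vmin].
Qed.

Lemma minimum_le (S : set R) (a : R) : S a -> 0 <= a -> minimum S <= a.
Proof.
move=> Sa a0; rewrite /minimum.
by case: xgetP => [m -> [_ lb]|_ //]; exact: lb.
Qed.

End Minimum.

(** * The connectivity constraint *)

Section Connected.
Context (R : realType) (n N : nat) (A : 'cV[R]_N -> 'M[R]_n).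
Hypotheses (A_C1 : continuously_differentiable A) (A_sym : forall x, (A x)^T = A x).
Hypotheses (A_ge0 : forall x i j, 0 <= A x i j).
Local Notation one := (const_mx 1 : 'cV[R]_n).
Local Notation K := [set v : 'cV[R]_n | unit_sphere v /\ one^T *m v = 0].
Local Notation I2 := [set p | (2 <= p <= n)%N].

(** The second eigenspace is then the kernel, so it contains the normalized
all-ones vector, at which the minimized form vanishes: the Laplacian of any
matrix annihilates that vector, and the derivative of a Laplacian is the
Laplacian of a derivative. If no minimum is attained, mu is 0 by
convention. *)
Lemma mu_le0 x u : (2 <= n)%N -> lam A 2 x = 0 -> mu A I2 x u <= 0.
Proof.
move=> n2 l0.
have n0 : (0 < n)%N by exact: ltnW.
have o0 : one != 0.
  by apply/matrix0Pn; exists (Ordinal n0), 0; rewrite mxE oner_eq0.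
set c := (Num.sqrt (dot one one))^-1.
apply: minimum_le => //; exists (c *: one).
  split; last exact: normalize.
  exists 1%N, (fun=> 1), (fun=> c *: one); split; last by rewrite big_ord1 scale1r.
  move=> _; exists 2%N; first by rewrite /= n2.
  split; first exact: normalize.
  by rewrite l0 scale0r -scalemxAr laplacian_one scaler0.
by rewrite -mulmxA -scalemxAr Lap_dotE // laplacian_one scaler0 mulmx0 mxE.
Qed.

Hypothesis lam2_neq0 : forall x, lam A 2 x != 0.

Lemma K_nonempty (x : 'cV[R]_N) : K !=set0.
Proof. by have [v [v1 ov _]] := lambda2_eigenvector (A_sym x) (lam2_neq0 x); exists v. Qed.

Lemma mu_attained x u : exists v, [/\ K v, mu A I2 x u = quad (Lap_dot A x u) v &
  forall w, K w -> quad (Lap_dot A x u) v <= quad (Lap_dot A x u) w].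
Proof.
rewrite /mu VI_connected //.
apply: (@minimum_image R 'cV[R]_n K (quad (Lap_dot A x u))).
- exact: compact_unit_ker.
- exact: K_nonempty.
- apply: (@continuous_quad _ _ _ (fun=> _) id); first exact: cst_continuous.
  by move=> ?; exact: cvg_id.
Qed.

(** Lower semicontinuity: a strict lower bound of the form on the compact K
persists nearby. Upper semicontinuity: a fixed minimizer gives an upper bound
nearby. *)
Lemma continuous_lam2 : continuous (lam A 2).
Proof.
have qc : continuous (fun p : 'cV[R]_N * 'cV[R]_n => quad (Lap A p.1) p.2).
  apply: (@continuous_quad _ _ _ (fun p => Lap A p.1) snd); last by move=> p; exact: cvg_snd.
  move=> p; apply: (@continuous_comp _ _ _ fst (Lap A)); first exact: cvg_fst.
  exact: continuous_Lap.
move=> x0; apply/(@cvgrPdist_lt R R 'cV[R]_N (nbhs x0)) => e e0.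
have [v [v1 ov v2]] := lambda2_eigenvector (A_sym x0) (lam2_neq0 x0).
have lo : \forall x \near x0, forall w, K w -> lam A 2 x0 - e < quad (Lap A x) w.
  apply: (@compact_near_lt R _ _ K (fun p => quad (Lap A p.1) p.2)
    (fun=> lam A 2 x0 - e)) => //.
  - exact: compact_unit_ker.
  - exact: (@cst_continuous 'cV[R]_N R).
  move=> w [w1 ow] /=.
  by have := lambda2_le_quad (A_sym x0) (A_ge0 x0) (lam2_neq0 x0) w1 ow; rewrite /lam /Lap; lra.
have cv : continuous (fun x => quad (Lap A x) v).
  apply: (@continuous_quad _ _ _ (Lap A) (fun=> v)); first exact: continuous_Lap.
  exact: cst_continuous.
apply: filterS2 lo ((cvgrPdist_lt _ _).1 (cv x0) _ e0) => x lo.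
rewrite [quad _ _]v2 => up.
have [w [w1 ow w2]] := lambda2_eigenvector (A_sym x) (lam2_neq0 x).
have := lo w (conj w1 ow); rewrite [quad _ _]w2 => lo'.
have := lambda2_le_quad (A_sym x) (A_ge0 x) (lam2_neq0 x) v1 ov.
move: up lo'; rewrite /lam /Lap ltr_norml => /andP[up1 up2] lo' up3.
move: up1 up2 lo' up3.
move: (lambda _ 2) (lambda _ 2) (quad _ v) (e); clear => a b c f *.
by rewrite ltr_norml; apply/andP; split; lra.
Qed.

Context (alpha : R -> R) (eps : R).
Hypothesis alpha_c : continuous alpha.
Let bound x := - alpha (lam A 2 x - eps).

Lemma continuous_bound : continuous bound.
Proof.
have c1 : continuous (fun x => lam A 2 x - eps).
  apply: (@continuous_sub R 'cV[R]_N (lam A 2) (fun=> eps)); first exact: continuous_lam2.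
  exact: cst_continuous.
have c2 : continuous (fun x => alpha (lam A 2 x - eps)).
  by move=> x; apply: (@continuous_comp _ _ _ (fun x => lam A 2 x - eps) alpha);
    [exact: c1|exact: alpha_c].
exact: continuous_opp.
Qed.

Lemma U_strP x u : U_str A alpha eps x u <->
  forall v, K v -> bound x <= quad (Lap_dot A x u) v.
Proof.
rewrite /U_str /= -/(bound x).
have [v [Kv -> vmin]] := mu_attained x u.
by split => [bv w Kw|]; [exact: le_trans (vmin w Kw)|apply].
Qed.

Let qd := fun p : ('cV[R]_N * 'cV[R]_N) * 'cV[R]_n => quad (Lap_dot A p.1.1 p.1.2) p.2.

Lemma continuous_quad_dot : continuous qd.
Proof.
apply: (@continuous_quad _ _ _ (fun p : ('cV[R]_N * 'cV[R]_N) * 'cV[R]_n =>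
  Lap_dot A p.1.1 p.1.2) snd); last by move=> p; exact: cvg_snd.
move=> p; apply: (@continuous_comp _ _ _ fst (fun q : 'cV[R]_N * 'cV[R]_N => Lap_dot A q.1 q.2)).
  exact: cvg_fst.
exact: continuous_Lap_dot.
Qed.

Lemma quad_dot_conv x u v (t : R) w :
  quad (Lap_dot A x (t *: u + (1 - t) *: v)) w =
  t * quad (Lap_dot A x u) w + (1 - t) * quad (Lap_dot A x v) w.
Proof.
rewrite Lap_dot_conv // quad_is_linear; congr (_ + _).
by rewrite /quad -scalemxAr -scalemxAl mxE.
Qed.

Lemma U_str_convex x u v (t : R) : U_str A alpha eps x u -> U_str A alpha eps x v ->
  0 <= t <= 1 -> U_str A alpha eps x (t *: u + (1 - t) *: v).
Proof.
move=> /U_strP uU /U_strP vU /andP[t0 t1]; apply/U_strP => w Kw.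
rewrite quad_dot_conv.
have := ler_wpM2l t0 (uU w Kw).
have t1' : 0 <= 1 - t by rewrite subr_ge0.
by have := ler_wpM2l t1' (vU w Kw); lra.
Qed.

Lemma U_str_closed x u : ~ U_str A alpha eps x u ->
  \forall p \near (x, u), ~ U_str A alpha eps p.1 p.2.
Proof.
move=> /U_strP/existsNP[v /not_implyP[Kv /negP]]; rewrite -ltNge => ub.
have gc : continuous (fun p : 'cV[R]_N * 'cV[R]_N => bound p.1 - qd (p, v)).
  apply: continuous_sub.
    move=> p; apply: (@continuous_comp _ _ _ fst bound); first exact: cvg_fst.
    exact: continuous_bound.
  move=> p; apply: (@continuous_comp _ _ _ (fun p => (p, v)) qd); last exact: continuous_quad_dot.
  exact: (@cvg_pair _ _ _ _ (nbhs p) (nbhs v) _ _ _ id (fun=> v) cvg_id (cvg_cst _)).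
have g0 : 0 < bound x - qd ((x, u), v) by rewrite subr_gt0.
apply: filterS ((cvgrPdist_lt _ _).1 (gc (x, u)) _ g0) => -[y w] /=.
rewrite ltr_norml ltrBlDr ltrDl subr_gt0 => /andP[_ h] /U_strP/(_ v Kv).
by rewrite leNgt h.
Qed.

(** The inequality is strict at w, hence at every point of the segment from u
to w except possibly u itself; a strict inequality on the compact K persists nearby. *)
Lemma U_str_slater x w : mu A I2 x w > bound x ->
  forall u t, U_str A alpha eps x u -> 0 < t <= 1 ->
  \forall y \near x, U_str A alpha eps y (t *: w + (1 - t) *: u).
Proof.
move=> ws u t /U_strP uU /andP[t0 t1]; set z := t *: w + _.
have [v [Kv muv vmin]] := mu_attained x w.
have : \forall y \near x, forall v, K v -> bound y < quad (Lap_dot A y z) v.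
  apply: (@compact_near_lt R _ _ K (fun p => quad (Lap_dot A p.1 z) p.2) bound).
  - exact: compact_unit_ker.
  - move=> p; apply: (@continuous_comp _ _ _ (fun p : 'cV[R]_N * 'cV[R]_n => ((p.1, z), p.2)) qd).
      apply: (@cvg_pair _ _ _ _ (nbhs (p.1, z)) (nbhs p.2) _ _ _ (fun p => (p.1, z)) snd).
        exact: (@cvg_pair _ _ _ _ (nbhs p.1) (nbhs z) _ _ _ fst (fun=> z) cvg_fst (cvg_cst _)).
      exact: cvg_snd.
    exact: continuous_quad_dot.
  - exact: continuous_bound.
  move=> y Ky /=; rewrite quad_dot_conv.
  have h1 : bound x < quad (Lap_dot A x w) y by rewrite (lt_le_trans ws) // muv vmin.
  have := uU y Ky; have t1' : 0 <= 1 - t by rewrite subr_ge0.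
  move=> /(ler_wpM2l t1'); have : t * bound x < t * quad (Lap_dot A x w) y by rewrite ltr_pM2l.
  lra.
apply: filterS => y yU; apply/U_strP => v' Kv'; exact/ltW/yU.
Qed.

End Connected.

(** * The nominal constraint *)

Section Nominal.
Context (R : realType) (N m : nat) (g : 'cV[R]_N * 'cV[R]_N -> 'cV[R]_m).
Hypothesis g_cont : continuous g.
Hypothesis g_conv : forall x i, convex_function setT (fun u => g (x, u) i 0).

Lemma g_conv_le x i u v (t : R) : 0 <= t <= 1 ->
  g (x, t *: u + (1 - t) *: v) i 0 <= t * g (x, u) i 0 + (1 - t) * g (x, v) i 0.
Proof.
move=> /andP[t0 t1].
exact: (g_conv x i (Itv01 t0 t1) (in_setT u) (in_setT v)).
Qed.

Lemma U_nom_convex x u v (t : R) : U_nom g x u -> U_nom g x v -> 0 <= t <= 1 ->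
  U_nom g x (t *: u + (1 - t) *: v).
Proof.
move=> uU vU t01 i; apply: le_trans (g_conv_le x i u v t01) _.
case/andP: t01 => t0 t1; have t1' : 0 <= 1 - t by rewrite subr_ge0.
have := ler_wpM2l t0 (uU i); have := ler_wpM2l t1' (vU i); rewrite !mulr0; lra.
Qed.

Lemma U_nom_closed x u : ~ U_nom g x u -> \forall p \near (x, u), ~ U_nom g p.1 p.2.
Proof.
move=> /existsNP[i /negP]; rewrite -ltNge => gi.
have gc : continuous (fun p => g p i 0) by exact: continuous_entry.
apply: filterS ((cvgrPdist_lt _ _).1 (gc (x, u)) _ gi) => -[y w].
by rewrite ltr_norml => /andP[_] h /(_ i) /=; move: h; lra.
Qed.

Lemma U_nom_slater x w : (forall i, g (x, w) i 0 < 0) ->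
  forall u t, U_nom g x u -> 0 < t <= 1 ->
  \forall y \near x, U_nom g y (t *: w + (1 - t) *: u).
Proof.
move=> ws u t uU /andP[t0 t1]; set z := t *: w + _.
suff H i : \forall y \near x, g (y, z) i 0 <= 0 by have := filter_forall _ H; apply.
have gc : continuous (fun y => - g (y, z) i 0).
  apply: continuous_opp => y.
  apply: (@continuous_comp _ _ _ (fun y => (y, z)) (fun p => g p i 0)).
    exact: (@cvg_pair _ _ _ _ (nbhs y) (nbhs z) _ _ _ id (fun=> z) cvg_id (cvg_cst _)).
  exact: continuous_entry.
have gi : 0 < - g (x, z) i 0.
  rewrite oppr_gt0; apply: le_lt_trans (g_conv_le x i w u _) _; first by rewrite ltW.
  have t1' : 0 <= 1 - t by rewrite subr_ge0.
  have := ler_wpM2l t1' (uU i); have : t * g (x, w) i 0 < 0 by rewrite pmulr_rlt0.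
  rewrite mulr0; lra.
apply: filterS ((cvgrPdist_lt _ _).1 (gc x) _ gi) => y.
by rewrite ltr_norml => /andP[_]; lra.
Qed.

End Nominal.

(** * Absolutely continuous paths *)

Section Path.
Context (R : realType) (V : normedModType R).

(** Continuity relative to [a, b]; at the end points nothing is known about x
outside the interval. *)
Lemma path_near (x : R -> V) (a b s0 : R) (P : set V) :
  abs_continuous a b x -> a <= s0 <= b -> (\forall z \near x s0, P z) ->
  \forall s \near s0, a <= s <= b -> P (x s).
Proof.
move=> xac /andP[as0 s0b] /nbhs_ballP[e /= e0 eP].
have [d d0 xd] := xac e e0.
have step p q : a <= p -> p <= q -> q <= b -> q - p < d -> `|x q - x p| < e.
  move=> ap pq qb qpd.
  have := xd 1%N (fun=> p) (fun=> q); rewrite !big_ord1; apply => //.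
  by move=> i j; rewrite !ord1 eqxx.
apply/nbhs_ballP; exists d => // s /=; rewrite /ball /= => sd /andP[as_ sb].
apply: eP; rewrite -ball_normE /=.
have [ss0|s0s] := leP s s0.
  by apply: step => //; apply: le_lt_trans sd; exact: ler_norm.
rewrite distrC; apply: step => //; first exact: ltW.
by apply: le_lt_trans sd; rewrite distrC ler_norm.
Qed.

Lemma path_bounded (x : R -> V) (a b : R) (m : V -> R) :
  abs_continuous a b x -> continuous m ->
  exists2 C, 0 <= C & forall s, a <= s <= b -> m (x s) <= C.
Proof.
move=> xac mc.
have cov := (near_covering_withinP `[a, b]%classic).2
  ((compact_near_coveringP _).1 (@segment_compact R a b)).
have [] := @filter_ex _ (pinfty_nbhs R) _ _ (filterI (nbhs_pinfty_ge (num_real 0))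
  (cov R (pinfty_nbhs R) (fun C s => m (x s) <= C) _ _)).
  move=> s0; rewrite /= in_itv /= => s0ab.
  have near_s0 := path_near xac s0ab ((cvgrPdist_lt _ _).1 (mc (x s0)) _ ltr01).
  exists ([set s | a <= s <= b -> `|m (x s0) - m (x s)| < 1], [set C | m (x s0) + 1 <= C]).
    by split; [exact: near_s0|exact: (nbhs_pinfty_ge (num_real (m (x s0) + 1)))].
  move=> [s C] [/= h hC]; rewrite in_itv /= => sab; have := h sab.
  by rewrite ltr_norml => /andP[+ _]; lra.
by move=> C [/= C0 hC]; exists C => // s sab; apply: hC; rewrite /= in_itv.
Qed.

End Path.

(** * Forward invariance *)

Section Invariance.
Context (R : realType) (n N : nat) (A : 'cV[R]_N -> 'M[R]_n).
Hypotheses (A_C1 : continuously_differentiable A) (A_sym : forall x, (A x)^T = A x).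
Hypotheses (A_ge0 : forall x i j, 0 <= A x i j) (lam2_neq0 : forall x, lam A 2 x != 0).
Context (alpha : R -> R) (eps : R) (alpha_K : extended_class_K alpha).
Context (k : 'cV[R]_N -> 'cV[R]_N) (k_str : forall x, U_str A alpha eps x (k x)).

(** The local Lipschitz constant is made explicit as a continuous function m of
the state, so that it is bounded along a path. *)
Lemma quad_Lap_local_lipschitz (v : 'cV[R]_n) : exists2 m : 'cV[R]_N -> R,
  continuous m & forall z,
  \forall y \near z, `|quad (Lap A y) v - quad (Lap A z) v| <= m z * `|y - z|.
Proof.
pose q i z := quad ('D_(delta_mx i 0) (Lap A) z) v.
exists (fun z => \sum_i `|q i z| + 1).
  apply: (@continuous_add R 'cV[R]_N _ (fun=> 1)); last exact: cst_continuous.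
  apply: (@continuous_sum R 'cV[R]_N _ (fun i z => `|q i z|)) => i.
  move=> y; apply: (@continuous_comp _ _ _ (q i) Num.norm); last exact: norm_continuous.
  move: y; apply: continuous_quad; last exact: cst_continuous.
  rewrite (_ : 'D_(delta_mx i 0) (Lap A) = fun z => laplacian ('d A z (delta_mx i 0))).
    move=> y; apply: (@continuous_comp _ _ _ (fun x => 'd A x (delta_mx i 0)) (@laplacian R n)).
      exact: A_C1.2.
    exact: continuous_laplacian.
  by apply/funext => y; exact: derive_Lap.
move=> z; have [dz dE] := quad_Lap_diff A_C1 z v.
apply: filterS (diff_estimate dz ltr01) => y; rewrite dE mul1r.
have qE : quad (Lap_dot A z (y - z)) v = \sum_i (y - z) i 0 * q i z.
  rewrite /quad /Lap_dot mulmx_sumr mulmx_suml summxE; apply: eq_bigr => i _.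
  by rewrite -scalemxAr -scalemxAl mxE.
have : `|quad (Lap_dot A z (y - z)) v| <= (\sum_i `|q i z|) * `|y - z|.
  rewrite qE (le_trans (ler_norm_sum _ _ _)) // mulr_suml ler_sum // => i _.
  by rewrite normrM mulrC ler_wpM2l // mx_norm_ge_entry.
rewrite mulrDl mul1r; set D := quad (Lap_dot _ _ _) _ => D1 D2.
set w := quad _ _ - quad _ _ in D2 *.
by rewrite -[w](subrK D) addrC (le_trans (ler_normD _ _)) // lerD.
Qed.

Lemma alpha_le0 (r : R) : r <= 0 -> alpha r <= 0.
Proof.
have [_ ah a0] := alpha_K.
by rewrite le_eqVlt => /predU1P[->|/ah]; rewrite a0 // => /ltW.
Qed.

(** While lambda_2 <= eps, the constraint on k makes the derivative of the form
along the path at least - alpha (lambda_2 - eps) >= 0, for each fixed v. *)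
Lemma quad_Lap_path_le (x : R -> 'cV[R]_N) (c T : R) (v : 'cV[R]_n) :
  c <= T -> abs_continuous c T x ->
  {ae (@lebesgue_measure R), forall s, c <= s <= T ->
     is_derive (s : R^o) (1 : R^o) (x : R^o -> 'cV[R]_N) (k (x s))} ->
  (forall s, c <= s < T -> lam A 2 (x s) <= eps) ->
  unit_sphere v -> (const_mx 1 : 'cV[R]_n)^T *m v = 0 ->
  quad (Lap A (x c)) v <= quad (Lap A (x T)) v.
Proof.
move=> cT xac xd xle v1 ov.
have [m mc mL] := quad_Lap_local_lipschitz v.
have [C C0 mC] := path_bounded xac mc.
pose phi s := quad (Lap A (x s)) v.
have pc : continuous (fun z => quad (Lap A z) v).
  by apply: continuous_quad; [exact: continuous_Lap|exact: cst_continuous].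
apply: (@ae_nondecreasing R _ x phi c T C) => //.
- move=> t ct tT e e0; rewrite near_withinE.
  have tcT : c <= t <= T by rewrite (ltW ct).
  apply: filterS (path_near xac tcT ((cvgrPdist_lt _ _).1 (pc (x t)) _ e0)) => s h st cs.
  have := h; rewrite cs (le_trans (ltW st) tT) => /(_ isT).
  rewrite -/(phi t) -/(phi s) ltr_norml => /andP[+ _].
  by rewrite ltrNl opprB ltrBlDl => /ltW.
- move=> t ct tT; rewrite near_withinE.
  have tcT : c <= t <= T by rewrite ct ltW.
  apply: filterS (path_near xac tcT (mL (x t))) => s h ts sT.
  have := h; rewrite (le_trans ct (ltW ts)) sT => /(_ isT).
  rewrite -/(phi t) -/(phi s) distrC => h1.
  apply: le_trans (ler_norm _) (le_trans h1 _).
  by rewrite ler_wpM2r // mC.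
apply: negligibleS xd => t; apply: contra_not => xd ct tT e e0; rewrite near_withinE.
have tcT : c <= t <= T by rewrite ct ltW.
have {xd}[dx Dx] := xd tcT.
have xdiff : differentiable (x : R^o -> 'cV[R]_N) (t : R^o) by exact/derivable1_diffP.
have [pd pE] := quad_Lap_diff A_C1 (x t) v.
have cd : differentiable (phi : R^o -> R^o) (t : R^o) by exact: (differentiable_comp xdiff pd).
have dE (h : R) : 'd (phi : R^o -> R^o) (t : R^o) h = h * quad (Lap_dot A (x t) (k (x t))) v.
  have dx1 : 'd (x : R^o -> 'cV[R]_N) (t : R^o) (1 : R^o) = k (x t).
    by rewrite -Dx; symmetry; exact: deriveE.
  have d1 : 'd (phi : R^o -> R^o) (t : R^o) (1 : R^o) = quad (Lap_dot A (x t) (k (x t))) v.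
    by have := diff_comp xdiff pd => /(congr1 (@^~ (1 : R^o))) /= ->; rewrite pE dx1.
  have := linearZ_LR ('d (phi : R^o -> R^o) (t : R^o)) h (1 : R^o).
  by rewrite [h *: (1 : R^o)]mulr1 d1.
have q0 : 0 <= quad (Lap_dot A (x t) (k (x t))) v.
  have /(U_strP A_sym A_ge0 lam2_neq0) kU := k_str (x t).
  apply: le_trans (kU v (conj v1 ov)); rewrite oppr_ge0.
  by apply: alpha_le0; rewrite subr_le0; apply: xle; rewrite ct.
apply: filterS (diff_estimate cd e0) => s; rewrite dE -/(phi s) -/(phi t) => h ts sT.
have st0 : 0 <= s - t by rewrite subr_ge0 ltW.
rewrite (ger0_norm st0) in h.
have := mulr_ge0 st0 q0; move: h; rewrite ler_norml => /andP[+ _].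
move: (phi s) (phi t) (e * (s - t)) ((s - t) * _) => a b f g h1 h2.
rewrite -lerN2 opprB; apply: le_trans h1 _; by rewrite gerBl.
Qed.

End Invariance.

Section Safety.
Context (R : realType) (n N : nat) (A : 'cV[R]_N -> 'M[R]_n).
Hypotheses (A_C1 : continuously_differentiable A) (A_sym : forall x, (A x)^T = A x).
Hypotheses (A_ge0 : forall x i j, 0 <= A x i j) (lam2_neq0 : forall x, lam A 2 x != 0).
Context (alpha : R -> R) (eps : R) (alpha_K : extended_class_K alpha).
Context (k : 'cV[R]_N -> 'cV[R]_N) (k_str : forall x, U_str A alpha eps x (k x)).

(** Below, c is the last time in [0, T] with lambda_2 >= eps. Besides
lambda_2 >= eps at time c, continuity gives lambda_2 <= eps there, which makes
[quad_Lap_path_le] applicable on [c, T] with c included. *)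
Lemma lam2_solution_ge (x0 : 'cV[R]_N) (I : set R) (x : R -> 'cV[R]_N) :
  C_ A eps x0 -> caratheodory_solution k x0 I x ->
  forall t, I t -> eps <= lam A 2 (x t).
Proof.
move=> x0C [[Iitv I0] [I_0 x_0] xac xd] T IT; rewrite leNgt; apply/negP => lT.
have T0 : 0 <= T by exact: I0.
have Iin s : 0 <= s <= T -> I s by exact: Iitv.
pose l s := lam A 2 (x s).
have l_near s e : 0 <= s <= T -> 0 < e ->
    \forall z \near s, 0 <= z <= T -> `|l s - l z| < e.
  move=> sT e0; apply: (path_near (P := fun y => `|l s - lam A 2 y| < e)
    (xac 0 T I_0 IT) sT).
  exact: ((cvgrPdist_lt _ _).1 (@continuous_lam2 _ _ _ _ A_C1 A_sym A_ge0 lam2_neq0 (x s)) _ e0).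
pose S := [set s | 0 <= s <= T /\ eps <= l s].
have S0 : S 0 by split; [rewrite lexx T0|rewrite /l x_0].
have Sub : has_ubound S by exists T => s [/andP[]].
set c := sup S.
have c0 : 0 <= c by exact: ub_le_sup.
have cT : c <= T by apply: ge_sup; [exists 0|move=> s [/andP[]]].
have c0T : 0 <= c <= T by rewrite c0 cT.
have lc_ge : eps <= l c.
  rewrite leNgt; apply/negP; rewrite -subr_gt0 => gap.
  have [d /= d0 dl] := (nbhs_ballP _ _).1 (l_near c _ c0T gap).
  have [s Ss cs] : exists2 s, S s & c - d < s.
    by apply: sup_adherent => //; split => //; exists 0.
  have sc : s <= c by exact: ub_le_sup.
  have [s0T ls] := Ss.
  have : ball c d s by rewrite /ball /= ger0_norm ?subr_ge0 // ltrBlDr addrC -ltrBlDr.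
  move=> /dl/(_ s0T); rewrite ltr_norml => /andP[+ _].
  by rewrite opprB ltrD2l ltrN2 ltNge ls.
have cltT : c < T.
  by rewrite lt_neqAle cT andbT; apply: contraL lT => /eqP <-; rewrite -leNgt.
have l_lt s : c < s -> s <= T -> l s < eps.
  move=> cs sT; rewrite ltNge; apply/negP => ls.
  have : s <= c.
    apply: (ub_le_sup Sub); split; last exact: ls.
    by rewrite (le_trans c0 (ltW cs)) sT.
  by rewrite leNgt cs.
have lc_le : l c <= eps.
  rewrite leNgt; apply/negP; rewrite -subr_gt0 => gap.
  have near_c : \forall s \near c^'+,
      [/\ 0 <= s <= T -> `|l c - l s| < l c - eps, c < s & s < T].
    near=> s; split; near: s; [|exact: nbhs_right_gt|exact: nbhs_right_lt].
    by rewrite near_withinE; apply: filterS (l_near c _ c0T gap) => s h _.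
  have [s [ls cs sT]] := filter_ex near_c.
  have := ls; rewrite (le_trans c0 (ltW cs)) (ltW sT) => /(_ isT).
  rewrite ltr_norml => /andP[_]; rewrite ltrD2l ltrN2 ltNge.
  by rewrite (ltW (l_lt s cs (ltW sT))).
have [v [v1 ov lv]] := lambda2_eigenvector (A_sym (x T)) (lam2_neq0 (x T)).
have := @quad_Lap_path_le _ _ _ _ A_C1 A_sym A_ge0 lam2_neq0 alpha eps alpha_K k k_str x c T v
  cT (xac c T (Iin c c0T) IT) _ _ v1 ov.
rewrite [X in _ -> _ -> _ <= X]lv; apply/not_implyP; split.
  apply: negligibleS xd => s; apply: contra_not => xds /andP[cs sT].
  by apply: xds; apply: Iin; rewrite (le_trans c0).
apply/not_implyP; split.
  move=> s /andP[]; rewrite le_eqVlt => /predU1P[<- //|cs] sT.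
  by apply/ltW/l_lt => //; exact: ltW.
apply/negP; rewrite -ltNge; apply: lt_le_trans lT _.
apply: le_trans lc_ge _.
exact: (lambda2_le_quad (A_sym (x c)) (A_ge0 (x c)) (lam2_neq0 (x c)) v1 ov).
Unshelve. all: by end_near. Qed.

End Safety.

Theorem theorem5p1 (R : realType) (n : nat) (hn : (2 <= n)%N)
    (d : 'I_n -> nat) (N : nat) (hN : N = (\sum_(r < n) d r)%N)
    (A : 'cV[R]_N -> 'M[R]_n)
    (A_C1 : continuously_differentiable A)
    (A_sym : forall x, (A x)^T = A x)
    (A_ge0 : forall x i j, 0 <= A x i j)
    (alpha : R -> R) (alpha_lip : locally_lipschitz alpha)
    (alpha_K : extended_class_K alpha)
    (eps : R) (eps_gt0 : 0 < eps)
    (J : 'cV[R]_N * 'cV[R]_N -> R)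
    (J_cont : continuous J)
    (J_conv : forall x, strictly_convex (fun u => J (x, u)))
    (dnom : nat) (g_nom : 'cV[R]_N * 'cV[R]_N -> 'cV[R]_dnom)
    (g_cont : continuous g_nom)
    (g_conv : forall x i, convex_function setT (fun u => g_nom (x, u) i 0))
    (slater : forall x, exists u,
       mu A [set p | (2 <= p <= n)%N] x u > - alpha (lam A 2 x - eps) /\
       forall i, g_nom (x, u) i 0 < 0)
    (k_str : 'cV[R]_N -> 'cV[R]_N)
    (k_strE : forall x,
       argmin (U_str A alpha eps x `&` U_nom g_nom x) (fun u => J (x, u))
         (k_str x)) :
  {within C_ A eps, continuous k_str} /\
  (forall (x0 : 'cV[R]_N) (I : set R) (x : R -> 'cV[R]_N),
     C_ A eps x0 -> caratheodory_solution k_str x0 I x ->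
     forall t, I t -> lam A 2 (x t) >= eps /\ graph_connected (A (x t))).
Proof.
have [alpha_c alpha_homo alpha0] := alpha_K.
have lam2_neq0 x : lam A 2 x != 0.
  apply/eqP => l0; have [u [+ _]] := slater x.
  rewrite l0 sub0r => /lt_le_trans/(_ (mu_le0 A_C1 u hn l0)).
  by rewrite oppr_lt0 -alpha0 ltNge ltW // alpha_homo // oppr_lt0.
have k_in x : U_str A alpha eps x (k_str x) by have [[]] := k_strE x.
split; last first.
  move=> x0 I x x0C xsol t It; split.
    exact: (lam2_solution_ge A_C1 A_sym A_ge0 lam2_neq0 alpha_K k_in x0C xsol).
  exact: (laplacian_connected (A_sym (x t)) (A_ge0 (x t)) (lam2_neq0 (x t))).
apply: continuous_subspaceT.
apply: (continuous_argmin J_cont J_conv _ _ _ k_strE).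
- move=> x u v t [us un] [vs vn] t01; split.
    exact: (U_str_convex A_C1 A_sym A_ge0 lam2_neq0).
  exact: U_nom_convex.
- move=> x u /not_andP[us|un].
    apply: filterS (U_str_closed A_C1 A_sym A_ge0 lam2_neq0 alpha_c us) => p nU [].
    by move=> /nU.
  by apply: filterS (U_nom_closed g_cont un) => p nU [_ /nU].
move=> x; have [w [ws wn]] := slater x; exists w => u t [us un] t01.
apply: filterI.
  exact: (U_str_slater A_C1 A_sym A_ge0 lam2_neq0 alpha_c ws us t01).
exact: (U_nom_slater g_cont g_conv wn un t01).
Qed.
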